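(* Each of the sets of abelian projections, finite projections and infinite projections is definable (relative to the class of all C*-algebras). Therefore the class of C*-algebras having an abelian projection, respectively a finite projection, respectively an infinite projection, is elementary.
   Context: Continuous logic for C*-algebras. A C*-algebra $A$ is viewed as a metric structure whose sorts are the balls $B_n(A)=\{a:\|a\|\le n\}$, $n\in\mathbb N$, with metric $\|x-y\|$, and whose functions are the restrictions to these balls of $+,\cdot,{}^*$, scalar multiplication by each $\lambda\in\mathbb C$, the constant $0$ and the inclusions $B_m\to B_n$. Terms are *-polynomials, atomic formulas are distances between terms, and formulas are obtained from atomic ones by applying continuous functions $f:\mathbb R^n\to\mathbb R$ and the quantifiers $\sup_x,\inf_x$ over a sort; $\varphi^A(\bar a)$ is the value of $\varphi$ at $\bar a$ in $A$. A class $\mathcal C$ is elementary if there is a set $T$ of sentences (formulas without free variables) such that $A\in\mathcal C$ iff $\varphi^A=0$ for all $\varphi\in T$. A definable predicate relative to an elementary class $\mathcal C$ is an assignment of functions to members of $\mathcal C$ that is a uniform limit, uniformly over all members of $\mathcal C$, of interpretations of formulas. A uniform assignment assigns to each $A\in\mathcal C$ a closed subset $X(A)$ of a fixed finite product of sorts, functorially (morphisms $A\to B$ restrict to isometric maps $X(A)\to X(B)$). It is a definable set relative to $\mathcal C$ if for every formula $\psi(\bar x,\bar y)$ the functions $\sup_{\bar x\in X(A)}\psi^A(\bar x,\bar y)$ and $\inf_{\bar x\in X(A)}\psi^A(\bar x,\bar y)$ are definable predicates relative to $\mathcal C$. A projection $p$ in $A$ is abelian if $pAp$ is abelian, finite if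 $pAp$ is finite, and infinite if $pAp$ is not finite. Here a C*-algebra is infinite if it has nonzero orthogonal projections $p,q$ with $p+q$ Murray--von Neumann equivalent to $p$, and finite if it is not infinite. *)

(* Defs.v *)
From HB Require Import structures.
From mathcomp Require Export all_boot all_order all_algebra.
From mathcomp Require Export all_classical all_reals all_analysis.
From mathcomp.real_closed Require Export complex.
Export Order.TTheory GRing.Theory Num.Theory.
Export numFieldNormedType.Exports.

Set Implicit Arguments.
Unset Strict Implicit.
Unset Printing Implicit Defensive.

Global Open Scope classical_set_scope.
Global Open Scope ring_scope.
Global Open Scope complex_scope.

HB.mixin Record isCstarAlgebra (R : realType) A
    of CompleteNormedModule R[i] A := {
  cmul : A -> A -> A ;
  cstar : A -> A ;
  cmulA : associative cmul ;
  cmulDl : left_distributive cmul +%R ;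
  cmulDr : right_distributive cmul +%R ;
  cmulZl : forall (l : R[i]) (x y : A), cmul (l *: x) y = l *: cmul x y ;
  cmulZr : forall (l : R[i]) (x y : A), cmul x (l *: y) = l *: cmul x y ;
  cstarK : involutive cstar ;
  cstarD : {morph cstar : x y / x + y} ;
  cstarZ : forall (l : R[i]) (x : A), cstar (l *: x) = l^*%C *: cstar x ;
  cstarM : forall x y : A, cstar (cmul x y) = cmul (cstar y) (cstar x) ;
  cnormM : forall x y : A, `|cmul x y| <= `|x| * `|y| ;
  cnorm_cstar : forall x : A, `|cmul (cstar x) x| = `|x| ^+ 2
}.

#[short(type="cstarAlgType")]
HB.structure Definition CstarAlgebra (R : realType) :=
  {A of isCstarAlgebra R A & CompleteNormedModule R[i] A}.

Notation "x ** y" := (cmul x y) (at level 40, left associativity) : ring_scope.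
Notation "x ^*'" := (cstar x) (at level 2, format "x ^*'") : ring_scope.

(* The norm of the library takes its values in [R[i]] (on the nonnegative
   reals); this is the same norm with values in [R]. *)
Definition rnorm (R : realType) (A : cstarAlgType R) (x : A) : R :=
  complex.Re `|x|.

Definition cball (R : realType) (A : cstarAlgType R) (n : nat) : set A :=
  [set x | rnorm x <= n%:R].

(* The product of the sorts B_(s 0), ..., B_(s (n - 1)). *)
Definition sorts_prod (R : realType) (A : cstarAlgType R) (n : nat)
    (s : 'I_n -> nat) : set 'rV[A]_n :=
  [set a | forall i, cball (s i) (a 0 i)].

(* [term R n] and [formula R n] have free variables x_0, ..., x_(n-1).  A bound
   variable carries its sort, and the sorts of the free variables are given
   together with a formula whenever its interpretations are considered.  Once
   the variables have sorts, the value of a *-polynomial lies in some ball, so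
   the inclusions between the sorts need no symbol, and the distance between
   any two terms is an atomic formula. *)
Inductive term (R : realType) (n : nat) : Type :=
| TVar of 'I_n
| TZero
| TAdd of term R n & term R n
| TMul of term R n & term R n
| TStar of term R n
| TScale of R[i] & term R n.

Inductive formula (R : realType) : nat -> Type :=
| FDist n of term R n & term R n : formula R n
| FConn n k (f : 'rV[R]_k -> R) of continuous f & ('I_k -> formula R n) :
    formula R n
| FSup n (s : nat) of formula R (1 + n) : formula R n
| FInf n (s : nat) of formula R (1 + n) : formula R n.

Fixpoint teval (R : realType) (A : cstarAlgType R) (n : nat) (t : term R n)
    (a : 'rV[A]_n) : A :=
  match t with
  | TVar i => a 0 i
  | TZero => 0
  | TAdd t1 t2 => teval t1 a + teval t2 a
  | TMul t1 t2 => teval t1 a ** teval t2 a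
  | TStar t1 => (teval t1 a)^*'
  | TScale l t1 => l *: teval t1 a
  end.

(* The quantified variable becomes x_0 and the other ones are shifted. *)
Fixpoint feval (R : realType) (A : cstarAlgType R) (n : nat)
    (phi : formula R n) : 'rV[A]_n -> R :=
  match phi in formula _ n return 'rV[A]_n -> R with
  | FDist _ t1 t2 => fun a => rnorm (teval t1 a - teval t2 a)
  | FConn _ k f _ phis => fun a => f (\row_j feval (phis j) a)
  | FSup _ s psi => fun a =>
      sup [set feval psi (row_mx (const_mx x : 'rV_1) a) | x in cball s]
  | FInf _ s psi => fun a =>
      inf [set feval psi (row_mx (const_mx x : 'rV_1) a) | x in cball s]
  end.

Definition sentence_value (R : realType) (A : cstarAlgType R)
    (phi : formula R 0) : R := feval phi (const_mx 0 : 'rV[A]_0).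

Definition elementary (R : realType) (C : cstarAlgType R -> Prop) : Prop :=
  exists T : formula R 0 -> Prop, forall A : cstarAlgType R,
    C A <-> (forall phi, T phi -> sentence_value A phi = 0).

Definition definable_predicate (R : realType) (C : cstarAlgType R -> Prop)
    (n : nat) (s : 'I_n -> nat)
    (P : forall A : cstarAlgType R, 'rV[A]_n -> R) : Prop :=
  exists phi : nat -> formula R n, forall e : R, 0 < e ->
    \forall k \near \oo, forall A : cstarAlgType R, C A ->
      forall a : 'rV[A]_n, sorts_prod s a -> `|P A a - feval (phi k) a| <= e.

(* The morphisms of an elementary class are the elementary embeddings: abelian
   projections, for instance, are not preserved by arbitrary embeddings. *)
Definition elementary_embedding (R : realType) (A B : cstarAlgType R)
    (j : A -> B) : Prop :=
  forall (n : nat) (phi : formula R n) (a : 'rV[A]_n),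
    feval phi (map_mx j a) = feval phi a.

Definition uniform_assignment (R : realType) (C : cstarAlgType R -> Prop)
    (m : nat) (s : 'I_m -> nat)
    (X : forall A : cstarAlgType R, set 'rV[A]_m) : Prop :=
  (forall A : cstarAlgType R, C A -> X A `<=` sorts_prod s /\ closed (X A)) /\
  (forall (A B : cstarAlgType R) (j : A -> B),
    C A -> C B -> elementary_embedding j ->
    (forall a, X A a -> X B (map_mx j a)) /\
    (forall a b, X A a -> X A b ->
       forall i, rnorm (map_mx j a 0 i - map_mx j b 0 i) =
                 rnorm (a 0 i - b 0 i))).

(* [X A] may be empty; the value [c] is then given to both functions. *)
Definition sup_over (R : realType) (A : cstarAlgType R) (m n : nat)
    (c : R) (X : set 'rV[A]_m) (psi : formula R (m + n)) (b : 'rV[A]_n) : R :=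
  if pselect (X !=set0) then sup [set feval psi (row_mx a b) | a in X] else c.

Definition inf_over (R : realType) (A : cstarAlgType R) (m n : nat)
    (c : R) (X : set 'rV[A]_m) (psi : formula R (m + n)) (b : 'rV[A]_n) : R :=
  if pselect (X !=set0) then inf [set feval psi (row_mx a b) | a in X] else c.

(* Quantifying over [c] makes the notion independent of the convention for the
   supremum and the infimum of the empty set. *)
Definition definable_set (R : realType) (C : cstarAlgType R -> Prop)
    (m : nat) (s : 'I_m -> nat)
    (X : forall A : cstarAlgType R, set 'rV[A]_m) : Prop :=
  uniform_assignment C s X /\
  forall (n : nat) (t : 'I_n -> nat) (psi : formula R (m + n)) (c : R),
    definable_predicate C t (fun A b => sup_over c (X A) psi b) /\
    definable_predicate C t (fun A b => inf_over c (X A) psi b).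

Definition projection (R : realType) (A : cstarAlgType R) (p : A) : Prop :=
  p^*' = p /\ p ** p = p.

Definition corner (R : realType) (A : cstarAlgType R) (p : A) : set A :=
  [set p ** x ** p | x in [set: A]].

(* The next three notions are those of a C*-algebra, for a C*-subalgebra [S]
   of [A] with the operations of [A]. *)
Definition abelian_subalg (R : realType) (A : cstarAlgType R) (S : set A) :
  Prop := forall x y, S x -> S y -> x ** y = y ** x.

Definition mvn_equiv (R : realType) (A : cstarAlgType R) (S : set A)
    (p q : A) : Prop :=
  exists2 v, S v & v^*' ** v = p /\ v ** v^*' = q.

Definition infinite_subalg (R : realType) (A : cstarAlgType R) (S : set A) :
  Prop :=
  exists p q : A, [/\ S p /\ S q, projection p /\ projection q,
    p != 0 /\ q != 0, p ** q = 0 & mvn_equiv S (p + q) p].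

Definition finite_subalg (R : realType) (A : cstarAlgType R) (S : set A) :
  Prop := ~ infinite_subalg S.

Definition abelian_projection (R : realType) (A : cstarAlgType R) (p : A) :
  Prop := projection p /\ abelian_subalg (corner p).

Definition finite_projection (R : realType) (A : cstarAlgType R) (p : A) :
  Prop := projection p /\ finite_subalg (corner p).

Definition infinite_projection (R : realType) (A : cstarAlgType R) (p : A) :
  Prop := projection p /\ ~ finite_subalg (corner p).

(* A set of elements of [A] as a set of 1-tuples. *)
Definition tuples1 (R : realType) (A : cstarAlgType R) (P : A -> Prop) :
  set 'rV[A]_1 := [set a | P (a 0 0)].

Definition all_cstar_algebras (R : realType) (A : cstarAlgType R) : Prop :=
  True.

(* Main.v *)
Require Import Defs.
From mathcomp Require Import ring lra.

Set Implicit Arguments.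
Unset Strict Implicit.
Unset Printing Implicit Defensive.

(** Each of the three sets is cut out of the set of projections by a formula
    with a gap: its value is nonpositive on the set and at least some [g > 0]
    at the other projections.  Since projections are weakly stable, an element
    at which the residuals of the projection equations and that formula are
    small is close to a member of the set, and this gives definability: the
    supremum of [psi] over the set is approximated by the supremum of
    [psi - K defect] over a ball, and the infimum of the defect tells whether
    the set is empty.

    The gaps are as follows.
    - If all commutators of contractions of [pAp] have norm at most [t < 1], a
      unitary [u] of [pAp] is central, because the distance from [u^n y u^*n]
      to [y] stays below [t |y|] although passing from [u] to [u^2] multiplies
      it by at least [2 - t]; unitaries near [p + i s x] then show that [pAp]
      is abelian.
    - [pAp] is infinite iff it has a nonunitary isometry [w], and then
      [p - w w^*] has norm 1; near-isometries are close to isometries.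
    The exact solutions near approximate ones come from polynomial iterations,
    so no functional calculus is involved. *)

(** * The real-valued norm and the elementary algebra of C*-algebras *)

Section Norm.
Variables (R : realType) (A : cstarAlgType R).
Implicit Types (x y z : A) (l : R[i]) (k : R).

Lemma rnormE x : `|x| = (rnorm x)%:C.
Proof. by rewrite /rnorm RRe_real//; exact: normr_real. Qed.

Lemma rnorm_ge0 x : 0 <= rnorm x.
Proof. by rewrite -ler0c -rnormE normr_ge0. Qed.

Lemma rnorm0 : rnorm (0 : A) = 0.
Proof. by rewrite /rnorm normr0. Qed.

Lemma rnorm_eq0 x : (rnorm x == 0) = (x == 0).
Proof. by rewrite -(normr_eq0 x) rnormE eq_complex/= eqxx andbT. Qed.

Lemma ler_rnormD x y : rnorm (x + y) <= rnorm x + rnorm y.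
Proof. by rewrite -lecR rmorphD/= -!rnormE ler_normD. Qed.

Lemma rnormN x : rnorm (- x) = rnorm x.
Proof. by rewrite /rnorm normrN. Qed.

Lemma rdistC x y : rnorm (x - y) = rnorm (y - x).
Proof. by rewrite -rnormN opprB. Qed.

Lemma ler_rnormB x y : rnorm (x - y) <= rnorm x + rnorm y.
Proof. by rewrite (le_trans (ler_rnormD _ _))// rnormN. Qed.

Lemma ler_rdistD z x y : rnorm (x - y) <= rnorm (x - z) + rnorm (z - y).
Proof. by rewrite (le_trans _ (ler_rnormD _ _))// addrA subrK. Qed.

Lemma ler_rdist x y : rnorm x <= rnorm y + rnorm (x - y).
Proof. by rewrite (le_trans _ (ler_rnormD _ _))// addrC subrK. Qed.

Lemma ler_rdist_dist x y : `|rnorm x - rnorm y| <= rnorm (x - y).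
Proof.
have := ler_rdist x y; have := ler_rdist y x; rewrite (rdistC y) => h1 h2.
by rewrite ler_norml; apply/andP; split; lra.
Qed.

Lemma rnormZ l x : rnorm (l *: x) = complex.Re `|l| * rnorm x.
Proof.
apply: complexI; rewrite rmorphM/= -!rnormE normrZ; congr (_ * _).
Qed.

Lemma rnormZr k x : rnorm (k%:C *: x) = `|k| * rnorm x.
Proof. by rewrite rnormZ normc_def/= expr0n addr0 sqrtr_sqr. Qed.

Lemma rnormM x y : rnorm (x ** y) <= rnorm x * rnorm y.
Proof. by rewrite -lecR rmorphM/= -!rnormE cnormM. Qed.

Lemma rnormMl c d x y : rnorm x <= c -> rnorm y <= d -> rnorm (x ** y) <= c * d.
Proof.
move=> xc yd; apply: le_trans (rnormM _ _) _.
by apply: ler_pM => //; exact: rnorm_ge0.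
Qed.

Lemma rnorm_starM x : rnorm (x^*' ** x) = rnorm x ^+ 2.
Proof. by apply: complexI; rewrite rmorphXn/= -!rnormE cnorm_cstar. Qed.

Lemma rnorm_star_le x : rnorm x <= rnorm x^*'.
Proof.
have [->|x0] := eqVneq x 0; first by rewrite rnorm0 rnorm_ge0.
have x0' : 0 < rnorm x by rewrite lt_def rnorm_eq0 x0 rnorm_ge0.
by rewrite -(ler_pM2r x0') -expr2 -rnorm_starM rnormM.
Qed.

Lemma rnorm_star x : rnorm x^*' = rnorm x.
Proof. by apply/le_anti; rewrite rnorm_star_le -{2}[x]cstarK rnorm_star_le. Qed.

Lemma cmul0l x : 0 ** x = 0.
Proof. by apply: (addrI (0 ** x)); rewrite -cmulDl !addr0. Qed.

Lemma cmul0r x : x ** 0 = 0.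
Proof. by apply: (addrI (x ** 0)); rewrite -cmulDr !addr0. Qed.

Lemma cmulNl x y : (- x) ** y = - (x ** y).
Proof. by apply: (addrI (x ** y)); rewrite -cmulDl !subrr cmul0l. Qed.

Lemma cmulNr x y : x ** (- y) = - (x ** y).
Proof. by apply: (addrI (x ** y)); rewrite -cmulDr !subrr cmul0r. Qed.

Lemma cmulBl x y z : (x - y) ** z = x ** z - y ** z.
Proof. by rewrite cmulDl cmulNl. Qed.

Lemma cmulBr x y z : z ** (x - y) = z ** x - z ** y.
Proof. by rewrite cmulDr cmulNr. Qed.

Lemma cstar0 : (0 : A)^*' = 0.
Proof. by apply: (addrI (0 : A)^*'); rewrite -cstarD !addr0. Qed.

Lemma cstarN x : (- x)^*' = - x^*'.
Proof. by apply: (addrI x^*'); rewrite -cstarD !subrr cstar0. Qed.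

Lemma cstarB x y : (x - y)^*' = x^*' - y^*'.
Proof. by rewrite cstarD cstarN. Qed.

Lemma cstarZr k x : (k%:C *: x)^*' = k%:C *: x^*'.
Proof. by rewrite cstarZ conjc_real. Qed.

End Norm.

(* Sums of signed nonempty words, a normal form for the identities of
   rings without unit. *)
Inductive nexp :=
| NVar of nat
| NAdd of nexp & nexp
| NMul of nexp & nexp
| NOpp of nexp
| NMuln of nexp & nat.

Fixpoint nnorm (e : nexp) : seq (bool * (nat * seq nat)) :=
  match e with
  | NVar i => [:: (false, (i, [::]))]
  | NAdd e1 e2 => nnorm e1 ++ nnorm e2
  | NMul e1 e2 =>
      [seq (u.1 (+) v.1, (u.2.1, u.2.2 ++ v.2.1 :: v.2.2)) | u <- nnorm e1,
        v <- nnorm e2]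
  | NOpp e1 => [seq (~~ u.1, u.2) | u <- nnorm e1]
  | NMuln e1 n => flatten (nseq n (nnorm e1))
  end.

Definition ncheck (e1 e2 : nexp) : bool :=
  let l := nnorm (NAdd e1 (NOpp e2)) in
  perm_eq [seq u.2 | u <- l & u.1] [seq u.2 | u <- l & ~~ u.1].

Section NonunitalRing.
Variables (R : realType) (A : cstarAlgType R) (env : nat -> A).

Fixpoint neval (e : nexp) : A :=
  match e with
  | NVar i => env i
  | NAdd e1 e2 => neval e1 + neval e2
  | NMul e1 e2 => neval e1 ** neval e2
  | NOpp e1 => - neval e1
  | NMuln e1 n => neval e1 *+ n
  end.

Definition weval (w : nat * seq nat) : A :=
  foldl (fun x i => x ** env i) (env w.1) w.2.

Definition seval (u : bool * (nat * seq nat)) : A :=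
  if u.1 then - weval u.2 else weval u.2.

Lemma weval_cat (u v : nat * seq nat) :
  weval (u.1, u.2 ++ v.1 :: v.2) = weval u ** weval v.
Proof.
case: v => i s; rewrite /weval foldl_cat/=.
elim/last_ind: s => //= s j IH.
by rewrite -!cats1 !foldl_cat/= IH cmulA.
Qed.

Lemma nnormP (e : nexp) : neval e = \sum_(u <- nnorm e) seval u.
Proof.
elim: e => [i|e1 IH1 e2 IH2|e1 IH1 e2 IH2|e IH|e IH n] /=.
- by rewrite big_seq1.
- by rewrite big_cat IH1 IH2.
- rewrite IH1 IH2 big_allpairs_dep/=.
  have suml (s : seq _) (y : A) : (\sum_(u <- s) seval u) ** y =
      \sum_(u <- s) (seval u ** y).
    elim: s => [|u s IH]; first by rewrite !big_nil cmul0l.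
    by rewrite !big_cons cmulDl IH.
  have sumr (s : seq _) (y : A) : y ** (\sum_(u <- s) seval u) =
      \sum_(u <- s) (y ** seval u).
    elim: s => [|u s IH]; first by rewrite !big_nil cmul0r.
    by rewrite !big_cons cmulDr IH.
  rewrite suml; apply: eq_bigr => u _; rewrite sumr; apply: eq_bigr => v _.
  rewrite /seval/= weval_cat.
  by case: u.1; case: v.1; rewrite ?cmulNl ?cmulNr ?opprK.
- rewrite big_map IH -sumrN; apply: eq_bigr => u _.
  by rewrite /seval/=; case: u.1; rewrite ?opprK.
- rewrite IH; elim: n => [|n IHn]/=; first by rewrite big_nil mulr0n.
  by rewrite mulrS big_cat/= IHn.
Qed.

(** The positive and the negative words of [e1 - e2] form the same multiset, so their sums
    cancel. *)
Lemma ncheckP (e1 e2 : nexp) : ncheck e1 e2 -> neval e1 = neval e2.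
Proof.
rewrite /ncheck => H; apply/eqP; rewrite -subr_eq0.
rewrite (_ : _ - _ = neval (NAdd e1 (NOpp e2)))// nnormP.
move: (nnorm _) H => l H; rewrite (bigID (fun u => u.1))/=.
rewrite (eq_bigr (fun u => - weval u.2)); last by rewrite /seval => u ->.
rewrite [X in _ + X](eq_bigr (fun u => weval u.2)); last first.
  by rewrite /seval => u /negbTE ->.
have E (P : pred (bool * (nat * seq nat))) :
    \sum_(u <- l | P u) weval u.2 =
    \sum_(w <- [seq u.2 | u <- l & P u]) weval w.
  by rewrite big_map big_filter.
by rewrite sumrN !E (perm_big _ H) addNr.
Qed.

End NonunitalRing.

Ltac nmem a l :=
  lazymatch l with
  | nil => constr:(false)
  | a :: _ => constr:(true)
  | _ :: ?l' => nmem a l'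
  end.
Ltac nadd a l := lazymatch nmem a l with true => l | false => constr:(a :: l) end.
Ltac natoms t l :=
  lazymatch t with
  | GRing.add ?a ?b => let l1 := natoms a l in natoms b l1
  | cmul ?a ?b => let l1 := natoms a l in natoms b l1
  | GRing.opp ?a => natoms a l
  | GRing.natmul ?a _ => natoms a l
  | _ => nadd t l
  end.
Ltac nindex a l :=
  lazymatch l with
  | a :: _ => constr:(0%N)
  | _ :: ?l' => let i := nindex a l' in constr:(S i)
  end.
Ltac nreify t l :=
  lazymatch t with
  | GRing.add ?a ?b =>
      let a1 := nreify a l in let b1 := nreify b l in constr:(NAdd a1 b1)
  | cmul ?a ?b =>
      let a1 := nreify a l in let b1 := nreify b l in constr:(NMul a1 b1)
  | GRing.opp ?a => let a1 := nreify a l in constr:(NOpp a1)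
  | GRing.natmul ?a ?n => let a1 := nreify a l in constr:(NMuln a1 n)
  | _ => let i := nindex t l in constr:(NVar i)
  end.
(** Adjoints, scalings and zero are atoms, so stars of sums and products have to be expanded
    beforehand. *)
Ltac ncring :=
  lazymatch goal with
  | |- @eq ?T ?a ?b =>
      let l0 := natoms a (@nil T) in let l := natoms b l0 in
      let a1 := nreify a l in let b1 := nreify b l in
      exact (@ncheckP _ _ (nth 0 l) a1 b1 isT)
  end.

(** * Geometric convergence and iterations that halve a residual *)

Lemma half_expn_small (R : realType) (C e : R) : 0 < e ->
  exists n : nat, C * 2^-1 ^+ n < e.
Proof.
move=> e0; have [C0|C0] := leP C 0.
  by exists 0; rewrite expr0 mulr1; exact: le_lt_trans e0.
exists (Num.bound (C / e)); rewrite exprVn ltr_pdivrMr ?exprn_gt0//.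
rewrite mulrC -ltr_pdivrMr//; apply: (lt_trans (archi_boundP _)).
  by rewrite divr_ge0// ltW.
by rewrite -natrX ltr_nat ltn_expl.
Qed.

Lemma half_expn_le0 (R : realType) (C x : R) :
  (forall n : nat, x <= C * 2^-1 ^+ n) -> x <= 0.
Proof.
move=> h; apply/ler_addgt0Pr => e /(half_expn_small C)[n /ltW hn].
by rewrite add0r; exact: le_trans (h n) hn.
Qed.

Section Completeness.
Variables (R : realType) (A : cstarAlgType R).

Lemma geometric_cvg (u : nat -> A) (C : R) :
  (forall n, rnorm (u n.+1 - u n) <= C * 2^-1 ^+ n) ->
  exists l, forall n, rnorm (l - u n) <= 2 * C * 2^-1 ^+ n.
Proof.
move=> hu.
(* Subtracting the tail of the geometric series lets the induction on [k] close. *)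
have hn n k : rnorm (u (k + n)%N - u n) <=
    2 * C * 2^-1 ^+ n - 2 * C * 2^-1 ^+ (k + n).
  elim: k => [|k IH]; first by rewrite !subrr rnorm0.
  apply: le_trans (ler_rdistD (u (k + n)%N) _ _) _.
  have := hu (k + n)%N; rewrite addSn exprS.
  by move: IH; set a := _ ^+ (k + n); set b := _ ^+ n; lra.
have C0 : 0 <= C.
  by have := hu 0; rewrite expr0 mulr1; exact: le_trans (rnorm_ge0 _).
have pos n : 0 <= 2 * C * 2^-1 ^+ n by rewrite mulr_ge0 ?exprn_ge0// mulr_ge0.
have hd n m : (n <= m)%N -> rnorm (u m - u n) <= 2 * C * 2^-1 ^+ n.
  move=> nm; have := hn n (m - n)%N; rewrite subnK// => /le_trans; apply.
  by rewrite gerBl.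
have cu : cauchy (u @ \oo).
  apply: cauchy_exP => eps eps0.
  (* The radius [eps] is a positive element of [R[i]]: its real part is positive and its imaginary
     part is zero. *)
  have e0 : 0 < complex.Re eps by move: eps0; rewrite ltcE => /andP[].
  have [N hN] := half_expn_small (2 * C) e0.
  exists (u N); exists N => // m /= Nm; rewrite -ball_normE/= rnormE ltcE/= rdistC.
  have -> : complex.Im eps = 0 by rewrite ger0_Im// ltW.
  rewrite eqxx/=; apply: le_lt_trans hN; exact: hd.
have /cvgrPdist_lt hl : cvg (u @ \oo) by exact/cauchy_cvgP.
exists (lim (u @ \oo)) => n; apply/ler_addgt0Pr => e e0.
have /hl[N _ hN] : 0 < e%:C by rewrite ltcR.
apply: le_trans (ler_rdistD (u (maxn n N)) _ _) _; rewrite addrC lerD//.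
  by rewrite hd// leq_maxl.
by rewrite -lecR -rnormE ltW// hN//= leq_maxr.
Qed.

(* The successive corrections are summable, as the residual [r] is halved. *)
Lemma halving_iteration (P : A -> Prop) (r : A -> R) (f : A -> A) (d C : R) :
  (forall x, P x -> r x <= d ->
    [/\ P (f x), r (f x) <= r x / 2 & rnorm (f x - x) <= C * r x]) ->
  (forall x, 0 <= r x) -> 0 <= C ->
  forall x, P x -> r x <= d ->
  exists l, rnorm (l - x) <= 2 * C * r x /\
    forall n : nat, exists y, [/\ P y, r y <= r x * 2^-1 ^+ n, r y <= d &
      rnorm (l - y) <= 2 * C * r x * 2^-1 ^+ n].
Proof.
move=> hf r0 C0 x Px rx.
have hu n : [/\ P (iter n f x), r (iter n f x) <= r x * 2^-1 ^+ n &
    r (iter n f x) <= d].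
  elim: n => [|n [IP Ir Id]]; first by rewrite /= expr0 mulr1.
  have [h1 h2 h3] := hf _ IP Id; rewrite /= exprS; split => //.
    by move: Ir h2; set a := _ ^+ n; set b := iter n f x; set c := r (f b); lra.
  by have := r0 (iter n f x); lra.
have [|l hl] := @geometric_cvg (fun n => iter n f x) (C * r x).
  move=> n; have [h1 h2 h3] := hu n; have [_ _] := hf _ h1 h3.
  move=> /le_trans; apply; rewrite -mulrA; exact: ler_wpM2l.
exists l; split; first by have := hl 0; rewrite expr0 mulr1 mulrA.
(* [P] is not assumed to be closed, so the limit comes with approximants satisfying [P], namely the
   iterates. *)
move=> n; exists (iter n f x); have [h1 h2 h3] := hu n.
by split => //; have := hl n; rewrite mulrA.
Qed.

End Completeness.

(** * Weak stability of projections and of isometries in a corner *)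

Section Stability.
Variables (R : realType) (A : cstarAlgType R).
Implicit Types (x y z p v w : A).

Lemma rnorm_le0 x : rnorm x <= 0 -> x = 0.
Proof. by move=> x0; apply/eqP; rewrite -rnorm_eq0 eq_le x0 rnorm_ge0. Qed.

Lemma ler_rnormMn x n : rnorm (x *+ n) <= rnorm x *+ n.
Proof.
elim: n => [|n IH]; first by rewrite !mulr0n rnorm0.
by rewrite !mulrS; apply: le_trans (ler_rnormD _ _) _; rewrite lerD2l.
Qed.

Lemma rnorm_projection p : projection p -> p != 0 -> rnorm p = 1.
Proof.
move=> [ps pp]; rewrite -rnorm_eq0 => p0.
by apply: (mulfI p0); rewrite -expr2 -rnorm_starM ps pp mulr1.
Qed.

Lemma rnorm_projection_le1 p : projection p -> rnorm p <= 1.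
Proof.
have [->|p0] := eqVneq p 0; first by rewrite rnorm0.
by move=> /rnorm_projection ->.
Qed.

Lemma rnorm_sqr_le x y c d : rnorm (x^*' ** x - y) <= c -> rnorm y <= d ->
  rnorm x ^+ 2 <= c + d.
Proof.
move=> xc yd; rewrite -rnorm_starM.
by apply: le_trans (ler_rdist _ y) _; rewrite addrC lerD.
Qed.

(* The iteration [a |-> 3 a^2 - 2 a^3] squares the residual [a^2 - a]. *)
Lemma projection_near (a : A) : a^*' = a -> rnorm (a ** a - a) <= 8^-1 ->
  exists2 p, projection p & rnorm (p - a) <= 10 * rnorm (a ** a - a).
Proof.
move=> as_ ad.
(* The C*-identity gives [|b|^2 <= 1/8 + |b|], which is false for [|b| > 2]. *)
have le2 (b : A) : b^*' = b -> rnorm (b ** b - b) <= 8^-1 -> rnorm b <= 2.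
  move=> bs; rewrite -{1}bs => bd.
  have := rnorm_sqr_le bd (lexx _); have := rnorm_ge0 b.
  move: (rnorm b) => {bs bd as_} t t0 ht; rewrite leNgt; apply/negP => t2; nra.
pose f b : A := b + (b ** b - b) - (b ** (b ** b - b)) *+ 2.
(* With [e = b^2 - b] the correction is [e - 2 b e], of norm at most [(1 + 2 * 2) |e|], whence the
   constant 5. *)
have [|b|//|l [l1 hl]] := @halving_iteration R A (fun b : A => b^*' = b)
    (fun b : A => rnorm (b ** b - b)) f 8^-1 5 _ _ _ a as_ ad.
- move=> b bs bd; rewrite /f; have b2 := le2 _ bs bd.
  set e := b ** b - b.
  have be : b ** e = e ** b by rewrite /e; ncring.
  have es : e^*' = e by rewrite /e cstarB cstarM !bs.
  split.
  + by rewrite mulr2n !(cstarB, cstarD, cstarM, es) bs -be.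
  (* For [|e| <= 1/8] the new residual is at most [(4/64 + 3/8) |e|], below [|e| / 2]. *)
  + rewrite (_ : _ - _ = e ** (e ** e) *+ 4 - e ** e *+ 3); last first.
      by rewrite /e; ncring.
    rewrite -/e in bd *; have e0 := rnorm_ge0 e.
    apply: le_trans (ler_rnormB _ _) _.
    apply: le_trans (lerD (ler_rnormMn _ _) (ler_rnormMn _ _)) _.
    have h2 := rnormM e e; have h3 := rnormMl (lexx (rnorm e)) h2.
    move: h2 h3; rewrite -!(mulr_natl (rnorm _)).
    set t := rnorm e in bd e0 *; set u := rnorm (e ** e).
    set s := rnorm _ => h2 h3.
    have h4 : t * (t * t) <= t * (8^-1 * 8^-1).
      by rewrite ler_wpM2l// ler_pM.
    have h5 : t * t <= t * 8^-1 by rewrite ler_wpM2l.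
    by lra.
  + rewrite (_ : _ - _ = e - (b ** e) *+ 2); last by rewrite /e; ncring.
    apply: le_trans (ler_rnormB _ _) _.
    have := ler_rnormMn (b ** e) 2; rewrite -mulr_natl.
    have := rnormMl b2 (lexx (rnorm e)); lra.
- exact: rnorm_ge0.
exists l; last by apply: le_trans l1 _; lra.
set t := rnorm (a ** a - a) in hl.
split.
  apply/eqP; rewrite -subr_eq0; apply/eqP/rnorm_le0.
  apply: (@half_expn_le0 _ (2 * (10 * t))) => n.
  have [y [ys _ _ hy]] := hl n; apply: le_trans (ler_rdistD y _ _) _.
  by rewrite -{1}ys -cstarB rnorm_star [rnorm (y - l)]rdistC; lra.
apply/eqP; rewrite -subr_eq0; apply/eqP/rnorm_le0.
(* The residual of [l] exceeds that of an approximant [y] by at most [(|l| + 3) |l - y|], where 3 is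
   [|y| + 1] with [|y| <= 2]. *)
apply: (@half_expn_le0 _ (t + (rnorm l + 3) * (10 * t))) => n.
have [y [ys yr yd hy]] := hl n.
rewrite (_ : _ - _ = (y ** y - y) + (l ** (l - y) + ((l - y) ** y - (l - y)))).
  apply: le_trans (ler_rnormD _ _) _; rewrite mulrDl lerD//.
  apply: le_trans (ler_rnormD _ _) _.
  have h1 := rnormMl (lexx (rnorm l)) (lexx (rnorm (l - y))).
  have h2 := rnormMl (lexx (rnorm (l - y))) (le2 _ ys yd).
  have h3 := ler_rnormB ((l - y) ** y) (l - y).
  have h4 : (rnorm l + 3) * rnorm (l - y) <=
      (rnorm l + 3) * (2 * 5 * t * 2^-1 ^+ n).
    by rewrite ler_wpM2l// addr_ge0// rnorm_ge0.
  lra.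
ncring.
Qed.

(* Newton-Schulz iteration [v |-> v (3 p - v^* v) / 2]: with
   [p - v^* v = 2 g], the next residual is [3 g^2 + 2 g^3]. *)
Lemma isometry_near p v : projection p -> p ** v = v -> v ** p = v ->
  rnorm (p - v^*' ** v) <= 2^-1 ->
  exists w, [/\ p ** w = w, w ** p = w, w^*' ** w = p &
    rnorm (w - v) <= 2 * rnorm (p - v^*' ** v)].
Proof.
move=> pP pv vp vd; have [ps pp] := pP; have p1 := rnorm_projection_le1 pP.
have le2 (u : A) : rnorm (p - u^*' ** u) <= 2^-1 -> rnorm u <= 2.
  rewrite rdistC => ud; have := rnorm_sqr_le ud p1; have := rnorm_ge0 u.
  move: (rnorm u) => {pv vp ps pp} t t0 ht.
  by rewrite leNgt; apply/negP => t2; nra.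
pose g u := (2^-1)%:C *: (p - u^*' ** u).
have gg u : p - u^*' ** u = g u + g u.
  rewrite /g -scalerDl -rmorphD/= (_ : _ + _ = 1) ?scale1r//.
  by rewrite -[LHS]/(2^-1 + 2^-1 : R); lra.
have gn u : rnorm (g u) = rnorm (p - u^*' ** u) / 2.
  by rewrite rnormZr mulrC ger0_norm.
have [|u|//|l [l1 hl]] := @halving_iteration R A
  (fun u : A => p ** u = u /\ u ** p = u)
  (fun u : A => rnorm (p - u^*' ** u)) (fun u => u + u ** g u) 2^-1 1 _ _ _ v
  (conj pv vp) vd.
- move=> u [pu up] ud; have u2 := le2 _ ud.
  have us : p ** u^*' = u^*' by rewrite -{1}ps -cstarM up.
  have pg : p ** g u = g u.
    by rewrite cmulZr cmulBr pp cmulA us.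
  have gp : g u ** p = g u.
    by rewrite cmulZl cmulBl pp -cmulA up.
  have gs : (g u)^*' = g u by rewrite cstarZr cstarB cstarM cstarK ps.
  split.
  + by rewrite cmulDr cmulDl cmulA pu up -cmulA gp.
  + have e0 := rnorm_ge0 (g u).
    have := gn u; move: gs pg gp (gg u) e0; set e := g u => gs pg gp ge e0 en.
    have hu : u^*' ** u = p - e - e.
      by rewrite -[RHS]addrA -opprD -ge opprB addrC subrK.
    have h1 : (p - e - e) ** e = e - e ** e - e ** e by rewrite !cmulBl pg.
    have h2 : e ** (p - e - e) = e - e ** e - e ** e by rewrite !cmulBr gp.
    rewrite (_ : p - _ = e ** (e ** e) *+ 2 + e ** e *+ 3); last first.
      rewrite cstarD cstarM gs.
      rewrite (_ : (u^*' + e ** u^*') ** (u + u ** e) = u^*' ** u +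
        (u^*' ** u) ** e + e ** (u^*' ** u) + e ** ((u^*' ** u) ** e)).
        rewrite hu h1 h2; ncring.
      ncring.
    apply: le_trans (ler_rnormD _ _) _.
    apply: le_trans (lerD (ler_rnormMn _ _) (ler_rnormMn _ _)) _.
    have k2 := rnormM e e; have k3 := rnormMl (lexx (rnorm e)) k2.
    move: k2 k3; rewrite -!(mulr_natl (rnorm _)) -en.
    (* The old residual is [2 |e|], so the new one must be at most [|e|]; this holds since
       [2/16 + 3/4 <= 1]. *)
    have : rnorm e <= 4^-1 by lra.
    move: e0; set t := rnorm e; set q := rnorm (e ** e).
    set s := rnorm _ => e0 et h3 h4.
    have h5 : t * (t * t) <= t * (4^-1 * 4^-1).
      by rewrite ler_wpM2l// ler_pM.
    have h6 : t * t <= t * 4^-1 by rewrite ler_wpM2l.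
    by lra.
  + rewrite (_ : _ - u = u ** g u); last by rewrite addrC addKr.
    by have := rnormMl u2 (lexx (rnorm (g u))); rewrite gn; lra.
- exact: rnorm_ge0.
set t := rnorm (p - v^*' ** v) in hl.
have l1' : rnorm (l - v) <= 2 * rnorm (p - v^*' ** v) by lra.
exists l; split => //.
- apply/eqP; rewrite -subr_eq0; apply/eqP/rnorm_le0.
  apply: (@half_expn_le0 _ (2 * (2 * t))) => n.
  have [y [[py yp] _ _ hy]] := hl n.
  rewrite (_ : _ - _ = p ** (l - y) - (l - y)).
    apply: le_trans (ler_rnormB _ _) _.
    by have := rnormMl p1 (lexx (rnorm (l - y))); lra.
  rewrite cmulBr py; ncring.
- apply/eqP; rewrite -subr_eq0; apply/eqP/rnorm_le0.
  apply: (@half_expn_le0 _ (2 * (2 * t))) => n.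
  have [y [[py yp] _ _ hy]] := hl n.
  rewrite (_ : _ - _ = (l - y) ** p - (l - y)).
    apply: le_trans (ler_rnormB _ _) _.
    by have := rnormMl (lexx (rnorm (l - y))) p1; lra.
  rewrite cmulBl yp; ncring.
apply/eqP; rewrite -subr_eq0; apply/eqP/rnorm_le0.
apply: (@half_expn_le0 _ (t + (rnorm l + 2) * (2 * t))) => n.
have [y [_ yr yd hy]] := hl n.
rewrite (_ : _ - _ = (l^*' ** (l - y) + (l - y)^*' ** y) - (p - y^*' ** y)).
  apply: le_trans (ler_rnormB _ _) _; rewrite addrC mulrDl lerD//.
  apply: le_trans (ler_rnormD _ _) _.
  have h1 := rnormMl (lexx (rnorm l^*')) (lexx (rnorm (l - y))).
  have h2 := rnormMl (lexx (rnorm (l - y)^*')) (le2 _ yd).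
  move: h1 h2; rewrite !rnorm_star => h1 h2.
  have h4 : (rnorm l + 2) * rnorm (l - y) <=
      (rnorm l + 2) * (2 * 1 * t * 2^-1 ^+ n).
    by rewrite ler_wpM2l// addr_ge0// rnorm_ge0.
  lra.
rewrite cstarB; ncring.
Qed.

End Stability.

(** * Corners of a projection and the gaps for commutativity and infiniteness *)

Section Corner.
Variables (R : realType) (A : cstarAlgType R) (p : A).
Hypothesis pP : projection p.
Implicit Types (x y z v w : A).

Lemma cornerP x : corner p x <-> p ** x = x /\ x ** p = x.
Proof.
have [_ pp] := pP; split=> [[y _ <-]|[px xp]].
  by split; rewrite ?cmulA ?pp// -cmulA pp.
by exists x => //; rewrite px xp.
Qed.

Lemma corner_compress x : corner p (p ** x ** p).
Proof. by exists x. Qed.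

Lemma compress_id x : corner p x -> p ** x ** p = x.
Proof. by move=> /cornerP[-> ->]. Qed.

Lemma rnorm_compress x : rnorm (p ** x ** p) <= rnorm x.
Proof.
have p1 := rnorm_projection_le1 pP.
have := rnormMl (rnormMl p1 (lexx (rnorm x))) p1.
by rewrite mul1r mulr1.
Qed.

Lemma corner_star x : corner p x -> corner p x^*'.
Proof.
have [ps _] := pP => /cornerP[px xp]; apply/cornerP.
by split; rewrite -{1}ps -cstarM ?xp ?px.
Qed.

Lemma rnorm_isometry w : w^*' ** w = p -> rnorm w <= 1.
Proof.
move=> ww; have := rnorm_projection_le1 pP; rewrite -ww rnorm_starM.
by rewrite -[leRHS](expr1n _ 2) ler_pXn2r// nnegrE ?rnorm_ge0.
Qed.

Lemma projection_range w : corner p w -> w^*' ** w = p ->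
  projection (w ** w^*').
Proof.
move=> /cornerP[_ wp] ww; split; first by rewrite cstarM cstarK.
by rewrite cmulA -[w ** w^*' ** w]cmulA ww wp.
Qed.

Lemma projection_defect w : corner p w -> w^*' ** w = p ->
  projection (p - w ** w^*').
Proof.
move=> wc ww; have [qs qq] := projection_range wc ww.
have [ps pp] := pP; move/cornerP: wc => [pw wp].
split; first by rewrite cstarB qs ps.
have pws : w^*' ** p = w^*' by rewrite -{1}ps -cstarM pw.
by rewrite cmulBl !cmulBr qq pp cmulA pw -cmulA pws subrr subr0.
Qed.

Section AbelianGap.
Variable t : R.
Hypothesis t1 : t < 1.
Hypothesis ht : forall x y, corner p x -> corner p y -> rnorm x <= 1 ->
  rnorm y <= 1 -> rnorm (x ** y - y ** x) <= t.

(** By homogeneity: nonzero elements are scaled to the unit ball of the corner. *)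
Lemma rnorm_commutator x y : corner p x -> corner p y ->
  rnorm (x ** y - y ** x) <= t * rnorm x * rnorm y.
Proof.
move=> xc yc.
have [->|x0] := eqVneq x 0.
  by rewrite cmul0l cmul0r subrr rnorm0 mulr0 mul0r.
have [->|y0] := eqVneq y 0.
  by rewrite cmul0l cmul0r subrr rnorm0 mulr0.
have pos z : z != 0 -> 0 < rnorm z.
  by move=> z0; rewrite lt_def rnorm_eq0 z0 rnorm_ge0.
have scale z : z != 0 -> corner p z ->
    corner p ((rnorm z)^-1%:C *: z) /\ rnorm ((rnorm z)^-1%:C *: z) <= 1.
  move=> z0 /cornerP[pz zp]; split.
    by apply/cornerP; rewrite cmulZr cmulZl pz zp.
  by rewrite rnormZr gtr0_norm ?invr_gt0 ?pos// mulVf// gt_eqF// pos.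
have [xc' x1] := scale _ x0 xc; have [yc' y1] := scale _ y0 yc.
have := ht xc' yc' x1 y1.
rewrite !cmulZl !cmulZr !scalerA [(rnorm y)^-1%:C * _]mulrC -scalerBr.
rewrite -rmorphM/= rnormZr ger0_norm; last first.
  by rewrite mulr_ge0 ?invr_ge0 ?rnorm_ge0.
by rewrite -invfM mulrC ler_pdivrMr ?mulrA// mulr_gt0 ?pos.
Qed.

(** The defect [p - w w^*] is the commutator of the contractions [w^*] and [w], so its norm is at
    most [t < 1]; as a projection it must then vanish. *)
Lemma isometry_unitary w : corner p w -> w^*' ** w = p -> w ** w^*' = p.
Proof.
move=> wc ww; have w1 := rnorm_isometry ww.
have qP := projection_defect wc ww.
apply/eqP; rewrite eq_sym -subr_eq0; apply/negP => /negP q0.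
have := ht (corner_star wc) wc; rewrite rnorm_star ww => /(_ w1 w1).
by rewrite rnorm_projection// leNgt t1.
Qed.

(* Passing from [w] to [w^2] multiplies the distance of [w y w^*] to [y] by at
   least [2 - t], although it stays bounded. *)
Lemma unitary_central w y : corner p w -> w^*' ** w = p -> corner p y ->
  w ** y = y ** w.
Proof.
move=> wc ww yc.
pose d (u z : A) := u ** z ** u^*' - z.
(* For unitary [u] the displacement is a commutator times [u^*], which bounds it by [t |z|]. *)
have dE u z : corner p u -> u ** u^*' = p -> corner p z ->
    d u z = (u ** z - z ** u) ** u^*'.
  by move=> uc uu /cornerP[_ zp]; rewrite cmulBl -[z ** u ** _]cmulA uu zp.
have d_le u z : corner p u -> u^*' ** u = p -> corner p z ->
    rnorm (d u z) <= t * rnorm z.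
  move=> uc uu zc; rewrite dE//; last exact: isometry_unitary.
  have u1 := rnorm_isometry uu; have u0 := rnorm_ge0 u.
  have t0 : 0 <= t.
    by apply: le_trans (ht uc uc u1 u1); exact: rnorm_ge0.
  have := rnormMl (rnorm_commutator uc zc) (lexx (rnorm u^*')).
  rewrite rnorm_star => /le_trans; apply.
  rewrite (_ : t * rnorm u * rnorm z * rnorm u =
    t * rnorm z * (rnorm u * rnorm u)); last by ring.
  by rewrite ler_piMr ?mulr_ge0 ?rnorm_ge0// mulr_ile1.
have dc u z : corner p u -> corner p z -> corner p (d u z).
  move=> uc zc; have /cornerP[pu up] := corner_star uc.
  move/cornerP: uc => [pu' _]; move/cornerP: zc => [pz zp].
  apply/cornerP; split; first by rewrite /d cmulBr !cmulA pu' pz.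
  by rewrite /d cmulBl zp -[u ** z ** _ ** p]cmulA up.
(* [1 + k (1 - t)] is the Bernoulli lower bound of [(2 - t)^k], the growth after [k] squarings of
   [u]. *)
have main k u : corner p u -> u^*' ** u = p ->
    (1 + k%:R * (1 - t)) * rnorm (d u y) <= t * rnorm y.
  elim: k u => [|k IH] u uc uu.
    by rewrite mul0r addr0 mul1r d_le.
  have /cornerP[pu up] := uc.
  have uuc : corner p (u ** u) by apply/cornerP; rewrite cmulA pu -cmulA up.
  have uuu : (u ** u)^*' ** (u ** u) = p.
    rewrite cstarM cmulA -[u^*' ** u^*' ** u]cmulA uu -cmulA pu //.
  apply: le_trans (IH _ uuc uuu).
  (* Conjugation by [u] is [1 + d u], and its square is conjugation by [u^2]. *)
  have -> : d (u ** u) y = d u (d u y) + d u y *+ 2.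
    by rewrite /d cstarM; ncring.
  have h1 : rnorm (d u y *+ 2) = 2 * rnorm (d u y).
    rewrite -scaler_nat -[2]/(2%:R) -(rmorph_nat (real_complex R)).
    by rewrite rnormZr ger0_norm.
  have h2 := ler_rdist (d u y *+ 2) (- d u (d u y)).
  rewrite opprK rnormN h1 [d u y *+ 2 + _]addrC in h2.
  have h3 := d_le _ _ uc uu (dc _ _ uc yc).
  have h4 := rnorm_ge0 (d u y).
  have h5 : (2 - t) * rnorm (d u y) <= rnorm (d u (d u y) + d u y *+ 2).
    by rewrite mulrBl; lra.
  have k0 : 0 <= k%:R * (1 - t) by rewrite mulr_ge0// subr_ge0 ltW.
  apply: le_trans (ler_wpM2l _ h5); last by lra.
  rewrite mulrA ler_wpM2r// -natr1.
  have : 0 <= k%:R * (1 - t) * (1 - t) by rewrite mulr_ge0// subr_ge0 ltW.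
  by set s := k%:R; lra.
have d0 : d w y = 0.
  apply: rnorm_le0; rewrite leNgt; apply/negP => d0.
  have dt : 0 < (1 - t) * rnorm (d w y) by rewrite mulr_gt0// subr_gt0.
  have := main (Num.bound (t * rnorm y / ((1 - t) * rnorm (d w y)))) w wc ww.
  apply/negP; rewrite -ltNge mulrDl mul1r -mulrA.
  rewrite -[ltLHS]add0r ltr_leD// -ler_pdivrMr// ltW// archi_boundP//.
  rewrite divr_ge0//; last exact: ltW.
  by apply: le_trans (d_le _ _ wc ww yc); exact: rnorm_ge0.
move: (d0); rewrite dE//; last exact: isometry_unitary.
move/(congr1 (cmul^~ w)); rewrite -cmulA ww cmul0l cmulBl.
have /cornerP[pw wp] := wc; have /cornerP[py yp] := yc.
by rewrite -!cmulA wp yp => /eqP; rewrite subr_eq0 => /eqP.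
Qed.

(* A self-adjoint [x] is, up to a term of order [s], the imaginary part of
   [u / s], where [u] is the unitary close to [p + i s x]. *)
Lemma selfadjoint_central x y : x^*' = x -> corner p x -> corner p y ->
  x ** y = y ** x.
Proof.
move=> xs xc yc; apply/eqP; rewrite -subr_eq0; apply/eqP/rnorm_le0.
have /cornerP[px xp] := xc; have [ps pp] := pP; have /cornerP[py yp] := yc.
apply: (@half_expn_le0 _ (2 * rnorm y)) => n.
set h := 2^-1 ^+ n; have h0 : 0 < h by rewrite exprn_gt0.
have h1 : h <= 1 by rewrite exprn_ile1//; lra.
set M := 1 + rnorm x ^+ 2.
have M1 : 1 <= M by rewrite lerDl sqr_ge0.
have M0 : 0 < M := lt_le_trans ltr01 M1.
(* This choice gives [s |x|^2 <= h / 2], so the residual of [p + i s x] has order [s h] and remains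
   small after division by [s]. *)
pose s := h / (2 * M).
have s0 : 0 < s by rewrite divr_gt0// mulr_gt0.
pose ix := Complex 0 s *: x.
have ixs : ix^*' = - ix.
  rewrite cstarZ xs -scaleNr; congr (_ *: _).
  by apply/eqP; rewrite eq_complex/= oppr0 !eqxx.
have ixn : rnorm ix = s * rnorm x.
  by rewrite rnormZ normc_def/= expr0n add0r sqrtr_sqr gtr0_norm.
have pix : p ** ix = ix by rewrite cmulZr px.
have ixp : ix ** p = ix by rewrite cmulZl xp.
(* The first-order terms cancel because [ix] is skew-adjoint. *)
have vv : p - (p + ix)^*' ** (p + ix) = ix ** ix.
  rewrite cstarD ps ixs cmulDl !cmulDr !cmulNl pp pix ixp; ncring.
have sx : s * rnorm x ^+ 2 <= h / 2.
  rewrite /s (_ : _ * _ = h / 2 * (rnorm x ^+ 2 / M)); last first.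
    by field; rewrite gt_eqF.
  rewrite ler_piMr//; first by rewrite divr_ge0// ltW.
  by rewrite ler_pdivrMr// mul1r lerDr.
have res : rnorm (ix ** ix) <= s * (h / 2).
  apply: le_trans (rnormM _ _) _; rewrite ixn.
  rewrite (_ : s * rnorm x * (s * rnorm x) = s * (s * rnorm x ^+ 2));
    last by ring.
  by rewrite ler_wpM2l// ltW.
have s1 : s <= 1.
  by rewrite ler_pdivrMr ?mulr_gt0//; lra.
have [| | |w [pw wp ww wv]] := @isometry_near _ _ p (p + ix) pP.
- by rewrite cmulDr pp pix.
- by rewrite cmulDl pp ixp.
- by rewrite vv; apply: le_trans res _; nra.
rewrite vv in wv.
have wc : corner p w by apply/cornerP.
(* Both [w] and [p] commute with [y], so only the error [w - (p + ix)] contributes to the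
   commutator. *)
have hE : ix ** y - y ** ix = y ** (w - (p + ix)) - (w - (p + ix)) ** y.
  rewrite !cmulBr !cmulBl (unitary_central wc ww yc) cmulDr cmulDl py yp; ncring.
have : rnorm (ix ** y - y ** ix) <= 2 * (2 * (s * (h / 2))) * rnorm y.
  rewrite hE; apply: le_trans (ler_rnormB _ _) _.
  have wv' : rnorm (w - (p + ix)) <= 2 * (s * (h / 2)) by lra.
  have k1 := rnormMl (lexx (rnorm y)) wv'.
  have k2 := rnormMl wv' (lexx (rnorm y)).
  lra.
rewrite cmulZl cmulZr -scalerBr rnormZ normc_def/= expr0n add0r sqrtr_sqr.
rewrite gtr0_norm// => k.
rewrite -(ler_pM2l s0); apply: le_trans k _; lra.
Qed.

Lemma abelian_gap : abelian_subalg (corner p).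
Proof.
move=> x y xc yc.
have /cornerP[px xp] := xc; have /cornerP[pxs xps] := corner_star xc.
have h1 : (x + x^*') ** y = y ** (x + x^*').
  apply: selfadjoint_central => //; first by rewrite cstarD cstarK addrC.
  by apply/cornerP; rewrite cmulDr cmulDl px pxs xp xps.
have h2 : (Complex 0 1 *: (x - x^*')) ** y = y ** (Complex 0 1 *: (x - x^*')).
  apply: selfadjoint_central => //.
    rewrite cstarZ cstarB cstarK -[in RHS]opprB scalerN -scaleNr.
    by congr (_ *: _); apply/eqP; rewrite eq_complex/= oppr0 !eqxx.
  by apply/cornerP; rewrite cmulZr cmulZl cmulBr cmulBl px pxs xp xps.
have {}h2 : (x - x^*') ** y = y ** (x - x^*').
  move: h2; rewrite cmulZl cmulZr; apply: scalerI.
  by rewrite eq_complex/= oner_eq0 andbF.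
have h3 : x ** y + x ** y = y ** x + y ** x.
  move: h1 h2; rewrite cmulDl cmulDr cmulBl cmulBr => h1 h2.
  have := congr2 +%R h1 h2.
  by rewrite addrACA [y ** x + _ + _]addrACA !subrr !addr0.
have two_neq0 : (1 + 1 : R[i]) != 0 by rewrite (pnatr_eq0 _ 2).
by apply: (scalerI two_neq0); rewrite !scalerDl !scale1r.
Qed.

End AbelianGap.

(** Given orthogonal [q], [r] and a partial isometry [w] from [e = q + r] onto [q], adding
    [f = p - e] yields an isometry of the corner with range [p - r]. Conversely, a nonunitary
    isometry [w] gives the pair [w w^*] and [p - w w^*]. *)
Lemma infinite_cornerP : infinite_subalg (corner p) <->
  exists w, [/\ corner p w, w^*' ** w = p & w ** w^*' != p].
Proof.
have [ps pp] := pP; split.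
  move=> [q [r [[/cornerP[pq qp] /cornerP[pr rp]] [[qs qq] [rs rr]] [q0 r0] qr
    [w wc [we wq]]]]].
  have /cornerP[pw wp] := wc.
  have rq : r ** q = 0 by rewrite -rs -qs -cstarM qr cstar0.
  set e := q + r in we.
  have ee : e ** e = e by rewrite /e cmulDl !cmulDr qq rr qr rq addr0 add0r.
  have es : e^*' = e by rewrite /e cstarD qs rs.
  (* By the C*-identity it suffices that [(w - w e)^* (w - w e)] vanishes, which follows from
     [w^* w = e]. *)
  have wee : w ** e = w.
    apply/eqP; rewrite eq_sym -subr_eq0 -rnorm_eq0 -sqrf_eq0 -rnorm_starM.
    rewrite cstarB cstarM es.
    rewrite (_ : _ ** _ = w^*' ** w - w^*' ** w ** e - e ** (w^*' ** w) +
      e ** (w^*' ** w) ** e); last by ncring.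
    by rewrite we !ee subrr sub0r addNr rnorm0.
  have qw : q ** w = w by rewrite -wq -cmulA we.
  have fw : (p - e) ** w = 0.
    have pq0 : (p - e) ** q = 0.
      by rewrite cmulBl /e [(q + r) ** q]cmulDl pq qq rq addr0 subrr.
    by rewrite -qw cmulA pq0 cmul0l.
  have wf : w ** (p - e) = 0 by rewrite cmulBr wp wee subrr.
  have fs : (p - e)^*' = p - e by rewrite cstarB ps es.
  have ff : (p - e) ** (p - e) = p - e.
    rewrite !cmulBr !cmulBl pp ee /e !cmulDr !cmulDl pq pr qp rp.
    by rewrite subrr subr0.
  have pf : p ** (p - e) = p - e.
    by rewrite cmulBr pp /e cmulDr pq pr.
  have fp : (p - e) ** p = p - e.
    by rewrite cmulBl pp /e cmulDl qp rp.
  have [f fE] : exists f, f = p - e by exists (p - e).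
  rewrite -!fE in fw wf fs ff pf fp.
  have wsf : w^*' ** f = 0 by rewrite -fs -cstarM fw cstar0.
  have fws : f ** w^*' = 0 by rewrite -fs -cstarM wf cstar0.
  exists (w + f); split.
  - by apply/cornerP; rewrite cmulDr cmulDl pw wp pf fp.
  - rewrite cstarD fs cmulDl !cmulDr fw ff we wsf addr0 add0r fE.
    by rewrite addrC subrK.
  - rewrite cstarD fs cmulDl !cmulDr wf ff wq fws addr0 add0r fE /e.
    rewrite (_ : q + (p - (q + r)) = p - r); last by ncring.
    by rewrite -[X in _ != X]addr0 (inj_eq (addrI _)) oppr_eq0.
move=> [w [wc ww wwp]]; have /cornerP[pw wp] := wc.
have [qs qq] := projection_range wc ww.
have rP := projection_defect wc ww.
have pws : w^*' ** p = w^*' by rewrite -{1}ps -cstarM pw.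
exists (w ** w^*'), (p - w ** w^*'); split => //.
- split; apply/cornerP; rewrite ?cmulBr ?cmulBl ?cmulA ?pw -?cmulA ?pws //.
  by rewrite pp.
- split; last by rewrite subr_eq0 eq_sym.
  (* If [w w^* = 0] then [p = p p = w^* (w w^* w) = 0], so [w w^* = p], against the choice of
     [w]. *)
  apply/eqP => q0; move: wwp; rewrite q0.
  have -> : p = 0; last by rewrite eqxx.
  by rewrite -pp -{1}ww -{1}ww -cmulA [w ** (_ ** _)]cmulA q0 cmul0l cmul0r.
- by rewrite cmulBr qq -cmulA pws subrr.
- by exists w => //; split => //; rewrite addrC subrK.
Qed.

(** Stability puts an isometry [w] within 1/4 of [v], and finiteness makes it unitary;
    [v v^* - w w^*] is then a sum of two terms of norm at most 1/4. *)
Lemma finite_gap v : finite_subalg (corner p) -> corner p v -> rnorm v <= 1 ->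
  rnorm (v^*' ** v - p) <= 8^-1 -> rnorm (v ** v^*' - p) <= 2^-1.
Proof.
move=> pf /cornerP[pv vp] v1 vd; rewrite rdistC in vd.
have [|w [pw wp ww wv]] := isometry_near pP pv vp; first by lra.
have wc : corner p w by apply/cornerP.
have wwp : w ** w^*' = p.
  by apply: contrapT => /eqP ?; apply/pf/infinite_cornerP; exists w.
have w1 := rnorm_isometry ww.
rewrite -wwp (_ : _ - _ = (v - w) ** v^*' + w ** (v - w)^*'); last first.
  by rewrite cstarB; ncring.
have vw : rnorm (v - w) <= 4^-1 by rewrite rdistC; lra.
apply: le_trans (ler_rnormD _ _) _.
have vs1 : rnorm v^*' <= 1 by rewrite rnorm_star.
have vws : rnorm (v - w)^*' <= 4^-1 by rewrite rnorm_star.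
have := rnormMl vw vs1; have := rnormMl w1 vws; lra.
Qed.

Lemma infinite_gap : infinite_subalg (corner p) ->
  exists w, [/\ corner p w, rnorm w <= 1, w^*' ** w = p &
    rnorm (w ** w^*' - p) = 1].
Proof.
move=> /infinite_cornerP[w [wc ww wwp]]; exists w; split => //.
  exact: rnorm_isometry.
rewrite rdistC rnorm_projection//; first exact: projection_defect.
by rewrite subr_eq0 eq_sym.
Qed.

End Corner.

(** * Estimates for suprema and infima of images *)

Section SupInf.
Variables (R : realType) (T : Type) (D : set T).
Implicit Types (f g : T -> R) (M e : R).

(** The supremum of an unbounded set of reals is a default value; hence the explicit bounds in this
    and the following lemmas. *)
Lemma le_sup_image f M x : (forall y, D y -> f y <= M) -> D x ->
  f x <= sup [set f y | y in D].
Proof.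
move=> fM Dx; apply: ub_le_sup; last by exists x.
by exists M => _ [y Dy <-]; exact: fM.
Qed.

Lemma sup_image_le f M : D !=set0 -> (forall y, D y -> f y <= M) ->
  sup [set f y | y in D] <= M.
Proof.
move=> [x Dx] fM; apply: ge_sup; first by exists (f x), x.
by move=> _ [y Dy <-]; exact: fM.
Qed.

Lemma inf_image_le f M x : (forall y, D y -> M <= f y) -> D x ->
  inf [set f y | y in D] <= f x.
Proof.
move=> fM Dx; apply: ge_inf; last by exists x.
by exists M => _ [y Dy <-]; exact: fM.
Qed.

Lemma le_inf_image f M : D !=set0 -> (forall y, D y -> M <= f y) ->
  M <= inf [set f y | y in D].
Proof.
move=> [x Dx] fM; apply: lb_le_inf; first by exists (f x), x.
by move=> _ [y Dy <-]; exact: fM.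
Qed.

Lemma sup_imageN f : sup [set - f y | y in D] = - inf [set f y | y in D].
Proof. by rewrite /inf opprK image_comp. Qed.

Lemma sup_image_bounded f M : D !=set0 -> (forall y, D y -> `|f y| <= M) ->
  `|sup [set f y | y in D]| <= M.
Proof.
move=> D0 fM; have [x Dx] := D0.
have fM' y : D y -> - M <= f y <= M by rewrite -ler_norml; exact: fM.
rewrite ler_norml sup_image_le//; last by move=> y /fM'/andP[].
rewrite andbT; have /andP[h _] := fM' _ Dx; apply: le_trans h _.
by apply: (@le_sup_image _ M) => // y /fM'/andP[].
Qed.

Lemma sup_image_dist f g M e : D !=set0 -> (forall y, D y -> f y <= M) ->
  (forall y, D y -> g y <= M) -> (forall y, D y -> `|f y - g y| <= e) ->
  `|sup [set f y | y in D] - sup [set g y | y in D]| <= e.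
Proof.
move=> D0 fM gM fg.
have h y : D y -> f y <= g y + e /\ g y <= f y + e.
  by move=> /fg; rewrite ler_norml => /andP[]; split; lra.
rewrite ler_distl; apply/andP; split; last first.
  apply: sup_image_le => // y Dy; have [] := h _ Dy; move=> /le_trans + _; apply.
  by rewrite lerD2r (le_sup_image gM).
rewrite lerBlDr; apply: sup_image_le => // y Dy; have [_] := h _ Dy.
by move=> /le_trans; apply; rewrite lerD2r (le_sup_image fM).
Qed.

Lemma inf_image_dist f g M e : D !=set0 -> (forall y, D y -> M <= f y) ->
  (forall y, D y -> M <= g y) -> (forall y, D y -> `|f y - g y| <= e) ->
  `|inf [set f y | y in D] - inf [set g y | y in D]| <= e.
Proof.
move=> D0 fM gM fg.
have -> : inf [set f y | y in D] - inf [set g y | y in D] =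
    sup [set - g y | y in D] - sup [set - f y | y in D].
  by rewrite !sup_imageN [RHS]addrC [X in _ = X + _]opprK.
apply: (sup_image_dist (M := - M)) => // y Dy; rewrite ?lerN2 ?fM ?gM//.
by rewrite opprK addrC fg.
Qed.

End SupInf.

(** * Bounds and moduli of continuity of formulas, uniform over all C*-algebras *)

Section UniformContinuity.
Variable R : realType.

Definition tuple_ball (A : cstarAlgType R) (n : nat) (N : R) (a : 'rV[A]_n) :=
  forall i, rnorm (a 0 i) <= N.

Definition tuple_dist_le (A : cstarAlgType R) (n : nat) (d : R)
  (a b : 'rV[A]_n) := forall i, rnorm (a 0 i - b 0 i) <= d.

Lemma teval_bounded n (t : term R n) (N : R) : exists2 M : R, 0 <= M &
  forall (A : cstarAlgType R) (a : 'rV[A]_n), tuple_ball N a ->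
    rnorm (teval t a) <= M.
Proof.
elim: t => [i||t1 [M1 p1 h1] t2 [M2 p2 h2]|t1 [M1 p1 h1] t2 [M2 p2 h2]
  |t [M p h]|l t [M p h]].
- exists (Num.max 0 N); first by rewrite le_max lexx.
  by move=> A a /(_ i) aN; rewrite le_max aN orbT.
- by exists 0 => // A a _; rewrite /= rnorm0.
- exists (M1 + M2); first exact: addr_ge0.
  by move=> A a aN; apply: le_trans (ler_rnormD _ _) _; rewrite lerD ?h1 ?h2.
- exists (M1 * M2); first exact: mulr_ge0.
  by move=> A a aN; apply: rnormMl; [exact: h1|exact: h2].
- by exists M => // A a aN; rewrite /= rnorm_star h.
- have l0 : 0 <= complex.Re `|l| by rewrite -ler0c RRe_real ?normr_real.
  exists (complex.Re `|l| * M); first exact: mulr_ge0.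
  by move=> A a aN; rewrite /= rnormZ ler_wpM2l ?h.
Qed.

Lemma teval_lipschitz n (t : term R n) (N : R) : exists2 K : R, 0 <= K &
  forall (A : cstarAlgType R) (a b : 'rV[A]_n) (d : R), 0 <= d ->
    tuple_ball N a -> tuple_ball N b -> tuple_dist_le d a b ->
    rnorm (teval t a - teval t b) <= K * d.
Proof.
elim: t => [i||t1 [K1 p1 h1] t2 [K2 p2 h2]|t1 [K1 p1 h1] t2 [K2 p2 h2]
  |t [K p h]|l t [K p h]].
- by exists 1 => // A a b d _ _ _ /(_ i); rewrite mul1r.
- by exists 0 => // A a b d _ _ _ _; rewrite /= subrr rnorm0 mul0r.
- exists (K1 + K2); first exact: addr_ge0.
  move=> A a b d d0 aN bN ab /=; rewrite opprD addrACA mulrDl.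
  by apply: le_trans (ler_rnormD _ _) _; rewrite lerD ?h1 ?h2.
- have [M1 q1 b1] := teval_bounded t1 N; have [M2 q2 b2] := teval_bounded t2 N.
  exists (K1 * M2 + M1 * K2); first by rewrite addr_ge0// mulr_ge0.
  move=> A a b d d0 aN bN ab /=.
  rewrite (_ : _ - _ = (teval t1 a - teval t1 b) ** teval t2 a +
    teval t1 b ** (teval t2 a - teval t2 b)); last by ncring.
  apply: le_trans (ler_rnormD _ _) _; rewrite mulrDl lerD//.
    by rewrite mulrAC; apply: rnormMl; [exact: h1|exact: b2].
  by rewrite -mulrA; apply: rnormMl; [exact: b1|exact: h2].
- exists K => // A a b d d0 aN bN ab /=.
  by rewrite -cstarB rnorm_star h.
- have l0 : 0 <= complex.Re `|l| by rewrite -ler0c RRe_real ?normr_real.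
  exists (complex.Re `|l| * K); first exact: mulr_ge0.
  move=> A a b d d0 aN bN ab /=.
  by rewrite -scalerBr rnormZ -mulrA ler_wpM2l ?h.
Qed.

Definition value_bound n (phi : formula R n) (N M : R) :=
  forall (A : cstarAlgType R) (a : 'rV[A]_n), tuple_ball N a ->
    `|feval phi a| <= M.

Definition value_modulus n (phi : formula R n) (N e d : R) :=
  forall (A : cstarAlgType R) (a b : 'rV[A]_n),
    tuple_ball N a -> tuple_ball N b -> tuple_dist_le d a b ->
    `|feval phi a - feval phi b| <= e.

Definition box k (M : R) : set 'rV[R]_k :=
  [set v | forall i, v ord0 i \in `[- M, M]].

Lemma box_compact k M : compact (box (k := k) M).
Proof.
apply: (@rV_compact _ _ (fun=> [set` `[- M, M]])).
by move=> _; exact: segment_compact.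
Qed.

Lemma continuous_box_bounded k (f : 'rV[R]_k -> R) (M : R) : continuous f ->
  \forall K \near +oo, forall v, box M v -> `|f v| <= K.
Proof.
move=> cf; have : bounded_set (f @` box M).
  apply: compact_bounded; apply: continuous_compact; last exact: box_compact.
  exact: continuous_subspaceT.
move=> [K [Kr hK]]; near=> L => v vM.
apply: (hK L); last by exists v.
by near: L; exact: nbhs_pinfty_gt.
Unshelve. all: by end_near. Qed.

(** Only [v] has to lie in the box: continuity at each of its points gives a local modulus, and
    compactness makes it uniform. *)
Lemma continuous_box_modulus k (f : 'rV[R]_k -> R) (M e : R) : continuous f -> 0 < e ->
  \forall d \near 0^'+, forall v w : 'rV[R]_k, box M v ->
    (forall i, `|v 0 i - w 0 i| <= d) ->
    `|f v - f w| <= e.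
Proof.
move=> cf e0.
have /compact_near_coveringP/(_ R 0^'+
  (fun d v => forall w : 'rV[R]_k, (forall i, `|v 0 i - w 0 i| <= d) ->
    `|f v - f w| <= e)) := @box_compact k M.
move=> H; have FF : Filter (0^'+ : set_system R) by exact: at_right_proper_filter.
apply: filterS (H FF _) => [d hd v w vM|v vM]; first exact: hd.
have e20 : 0 < e / 2 by rewrite divr_gt0.
have /cvgrPdist_lt/(_ _ e20)/nbhs_ballP[r /= r0 hr] := cf v.
have r20 : 0 < r / 2 by rewrite divr_gt0.
(* Half radii keep both [v'] and every [w] within [r / 2] of [v'] inside the ball of radius [r]
   about [v]. *)
exists (ball v (r / 2), [set d | d < r / 2]).
  by split; [exact: nbhsx_ballx|exact: nbhs_right_lt].
move=> [v' d] [/= [_ v'v] dr] w v'w.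
have h1 : `|f v - f v'| < e / 2.
  apply: hr; split=> // i j; apply: le_ball (v'v i j).
  by rewrite ler_pdivrMr// ler_pMr// ler1n.
have h2 : `|f v - f w| < e / 2.
  apply: hr; split=> // i j; rewrite [r]splitr.
  apply: ball_triangle (v'v i j) _; rewrite -ball_normE/= ord1.
  exact: le_lt_trans (v'w j) dr.
rewrite -(subrKA (f v)) [e]splitr; apply: le_trans (ler_normD _ _) _.
by rewrite lerD// ltW// distrC.
Qed.

Lemma tuple_ball_cons (A : cstarAlgType R) n (s : nat) (N : R) (x : A)
    (a : 'rV[A]_n) : cball s x -> tuple_ball N a ->
  tuple_ball (Num.max N s%:R) (row_mx (const_mx x : 'rV_1) a).
Proof.
move=> xs aN i; case: (split_ordP i) => j ->.
  by rewrite row_mxEl mxE le_max xs orbT.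
by rewrite row_mxEr le_max aN.
Qed.

Lemma tuple_dist_le_cons (A : cstarAlgType R) m n (d : R) (x y : 'rV[A]_m)
    (a b : 'rV[A]_n) : tuple_dist_le d x y -> tuple_dist_le d a b ->
  tuple_dist_le d (row_mx x a) (row_mx y b).
Proof.
move=> xy ab i; case: (split_ordP i) => j ->.
  by rewrite !row_mxEl.
by rewrite !row_mxEr.
Qed.

Lemma tuple_dist_le_refl (A : cstarAlgType R) m (d : R) (x : 'rV[A]_m) :
  0 <= d -> tuple_dist_le d x x.
Proof. by move=> d0 i; rewrite subrr rnorm0. Qed.

Lemma cball_neq0 (A : cstarAlgType R) s : @cball R A s !=set0.
Proof. by exists 0; rewrite /cball/= rnorm0. Qed.

(** At a connective the values of the subformulas stay in a compact box; at a quantifier the radius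
    grows to include the new sort. The filter form combines the bounds of finitely many
    subformulas. *)
Lemma feval_bounded n (phi : formula R n) (N : R) :
  \forall M \near +oo, value_bound phi N M.
Proof.
elim: phi N => {n} [n t1 t2|n k f cf phis IH|n s psi IH|n s psi IH] N.
- have [M1 _ h1] := teval_bounded t1 N; have [M2 _ h2] := teval_bounded t2 N.
  near=> M => A a aN /=; rewrite ger0_norm ?rnorm_ge0//.
  apply: le_trans (ler_rnormB _ _) _.
  apply: (@le_trans _ _ (M1 + M2)); first by rewrite lerD ?h1 ?h2.
  by near: M; apply: nbhs_pinfty_ge; exact: num_real.
- have [K hK] := filter_ex (filter_forall _ (fun j => IH j N)).
  have := continuous_box_bounded K cf; apply: filterS => M hM A a aN /=.
  by apply: hM => i; rewrite mxE in_itv/= -ler_norml; exact: hK.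
- have := IH (Num.max N s%:R); apply: filterS => M hM A a aN /=.
  apply: sup_image_bounded; first exact: cball_neq0.
  by move=> x xs; apply: hM; exact: tuple_ball_cons.
- have := IH (Num.max N s%:R); apply: filterS => M hM A a aN /=.
  rewrite -normrN -sup_imageN.
  apply: sup_image_bounded; first exact: cball_neq0.
  by move=> x xs; rewrite normrN; apply: hM; exact: tuple_ball_cons.
Unshelve. all: by end_near. Qed.

(** A quantifier keeps the modulus of its body, since both sides range over the same ball;
    [feval_bounded] ensures that the suprema and infima are genuine. *)
Lemma feval_uniformly_continuous n (phi : formula R n) (N e : R) : 0 < e ->
  \forall d \near 0^'+, value_modulus phi N e d.
Proof.
elim: phi N e => {n} [n t1 t2|n k f cf phis IH|n s psi IH|n s psi IH] N e e0.
- have [K1 p1 h1] := teval_lipschitz t1 N; have [K2 p2 h2] := teval_lipschitz t2 N.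
  have K0 : 0 < K1 + K2 + 1 by lra.
  have eK : 0 < e / (K1 + K2 + 1) by rewrite divr_gt0.
  near=> d => A a b aN bN ab /=.
  have d0 : 0 < d by near: d; exact: nbhs_right_gt.
  apply: le_trans (ler_rdist_dist _ _) _; rewrite opprD addrACA -opprD.
  apply: le_trans (ler_rnormB _ _) _.
  have := h1 _ _ _ _ (ltW d0) aN bN ab; have := h2 _ _ _ _ (ltW d0) aN bN ab.
  move=> k1 k2.
  apply: (@le_trans _ _ ((K1 + K2 + 1) * d)); first by lra.
  by rewrite mulrC -ler_pdivlMr//; near: d; exact: nbhs_right_le.
- have [K hK] := filter_ex (filter_forall _ (fun j => feval_bounded (phis j) N)).
  have [d0 [d00 hd0]] :=
    filter_ex (filterI (nbhs_right_gt 0) (continuous_box_modulus K cf e0)).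
  apply: filterS (filter_forall _ (fun j => IH j N d0 d00)) => d hd.
  move=> A a b aN bN ab /=; apply: hd0 => i.
    by rewrite mxE in_itv/= -ler_norml; exact: hK.
  by rewrite !mxE; exact: hd.
- have [M hM] := filter_ex (feval_bounded psi (Num.max N s%:R)).
  have := IH (Num.max N s%:R) e e0.
  have d0 : \forall d \near (0^'+ : set_system R), 0 < d by exact: nbhs_right_gt.
  apply: filterS2 d0 => d d0 hd A a b aN bN ab /=.
  apply: (@sup_image_dist _ _ _ _ _ M); first exact: cball_neq0.
  + by move=> x xs; apply: le_trans (ler_norm _) _; apply/hM/tuple_ball_cons.
  + by move=> x xs; apply: le_trans (ler_norm _) _; apply/hM/tuple_ball_cons.
  + move=> x xs; apply: hd; try exact: tuple_ball_cons.
    by apply: tuple_dist_le_cons => //; apply: tuple_dist_le_refl; exact: ltW.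
- have [M hM] := filter_ex (feval_bounded psi (Num.max N s%:R)).
  have := IH (Num.max N s%:R) e e0.
  have d0 : \forall d \near (0^'+ : set_system R), 0 < d by exact: nbhs_right_gt.
  apply: filterS2 d0 => d d0 hd A a b aN bN ab /=.
  have lowM (c : 'rV[A]_(1 + n)) :
      tuple_ball (Num.max N s%:R) c -> - M <= feval psi c.
    by move=> /hM; rewrite ler_norml => /andP[].
  apply: (inf_image_dist (M := - M)); first exact: cball_neq0.
  + by move=> x xs; apply/lowM/tuple_ball_cons.
  + by move=> x xs; apply/lowM/tuple_ball_cons.
  + move=> x xs; apply: hd; try exact: tuple_ball_cons.
    by apply: tuple_dist_le_cons => //; apply: tuple_dist_le_refl; exact: ltW.
Unshelve. all: by end_near. Qed.

End UniformContinuity.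

(** * The continuous connectives used below *)

Section Connectives.
Variables (R : realType) (n : nat).
Implicit Types phi psi : formula R n.

Definition fbin (f : R -> R -> R)
    (cf : continuous (fun v : 'rV[R]_2 => f (v 0 0) (v 0 1))) phi psi :=
  FConn cf (fun j => if j == 0 then phi else psi).

Lemma fbinE f cf phi psi (A : cstarAlgType R) (a : 'rV[A]_n) :
  feval (@fbin f cf phi psi) a = f (feval phi a) (feval psi a).
Proof. by rewrite /= !mxE. Qed.

Lemma max_coord_continuous :
  continuous (fun v : 'rV[R]_2 => Num.max (v 0 0) (v 0 1)).
Proof. by move=> v; apply: continuous_max; exact: coord_continuous. Qed.

Definition fmax phi psi := @fbin Num.max max_coord_continuous phi psi.

Lemma fmaxE phi psi (A : cstarAlgType R) (a : 'rV[A]_n) :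
  feval (fmax phi psi) a = Num.max (feval phi a) (feval psi a).
Proof. exact: fbinE. Qed.

Lemma affine_coord_continuous (k l m : R) :
  continuous (fun v : 'rV[R]_2 => k + l * v 0 0 + m * v 0 1).
Proof.
move=> v; have c (i : 'I_2) := @coord_continuous R 1 2 0 i v.
exact (cvgD (cvgD (cvg_cst k) (cvgM (cvg_cst l) (c 0)))
  (cvgM (cvg_cst m) (c 1))).
Qed.

(** With [m = 0] and one formula given twice, this acts as a unary connective. *)
Definition faffine (k l m : R) phi psi := 
  @fbin (fun u v => k + l * u + m * v) (@affine_coord_continuous k l m) phi psi.

Lemma faffineE k l m phi psi (A : cstarAlgType R) (a : 'rV[A]_n) :
  feval (faffine k l m phi psi) a = k + l * feval phi a + m * feval psi a.
Proof. by rewrite [LHS]fbinE. Qed.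

(** A continuous switch, for use with the inverse of a threshold as [eta]: it gives [v] at [u = 0]
    and [c] as soon as [eta * u >= 1]. *)
Definition interpolate (eta c u v : R) : R :=
  (1 - Num.min 1 (eta * u)) * v + Num.min 1 (eta * u) * c.

Lemma interpolate_coord_continuous (eta c : R) :
  continuous (fun v : 'rV[R]_2 => interpolate eta c (v 0 0) (v 0 1)).
Proof.
move=> v.
have c0 (i : 'I_2) := @coord_continuous R 1 2 0 i v.
have h : {for v, continuous (fun w : 'rV[R]_2 => Num.min 1 (eta * w 0 0))}.
  apply: (@continuous_min R _ (fun=> 1) (fun w : 'rV[R]_2 => eta * w 0 0)).
    exact (@cst_continuous 'rV[R]_2 R 1 v).
  exact (cvgM (cvg_cst eta) (c0 0)).
exact (cvgD (cvgM (cvgB (cvg_cst (1 : R)) h) (c0 1)) (cvgM h (cvg_cst c))).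
Qed.

Definition finterpolate eta c phi psi :=
  @fbin (interpolate eta c) (@interpolate_coord_continuous eta c) phi psi.

Lemma finterpolateE eta c phi psi (A : cstarAlgType R) (a : 'rV[A]_n) :
  feval (finterpolate eta c phi psi) a =
    interpolate eta c (feval phi a) (feval psi a).
Proof. exact: fbinE. Qed.

End Connectives.

(** * Definability and axiomatizability from a gap formula *)

Lemma definable_predicateP (R : realType) (C : cstarAlgType R -> Prop) n
    (s : 'I_n -> nat) (P : forall A : cstarAlgType R, 'rV[A]_n -> R) :
  (forall e, 0 < e -> exists phi : formula R n, forall A, C A ->
    forall a : 'rV[A]_n, sorts_prod s a -> `|P A a - feval phi a| <= e) ->
  definable_predicate C s P.
Proof.
move=> H.
have /choice[phi hphi] : forall k : nat, exists phi : formula R n,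
    forall A, C A -> forall a : 'rV[A]_n, sorts_prod s a ->
    `|P A a - feval phi a| <= k.+1%:R^-1.
  by move=> k; apply: H; rewrite invr_gt0.
exists phi => e e0; have := near_infty_natSinv_lt (PosNum e0).
apply: filterS => k ke A CA a sa.
by apply: le_trans (hphi k A CA a sa) _; exact: ltW.
Qed.

Lemma sorts_prod_tuple_ball (R : realType) (A : cstarAlgType R) n
    (t : 'I_n -> nat) (b : 'rV[A]_n) : sorts_prod t b ->
  tuple_ball (\max_i t i)%:R b.
Proof.
move=> tb i; apply: le_trans (tb i) _; rewrite ler_nat.
exact: leq_bigmax.
Qed.

Definition cons_row (R : realType) (A : cstarAlgType R) n (x : A)
  (b : 'rV[A]_n) : 'rV[A]_(1 + n) := row_mx (const_mx x : 'rV_1) b.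

(* The dummy variables [b] dispense with renaming variables in formulas. *)
Definition gap_formula (R : realType) (X : forall A : cstarAlgType R, A -> Prop)
    (theta : forall n, formula R (1 + n)) (g : R) : Prop :=
  forall (A : cstarAlgType R) (p : A) n (b : 'rV[A]_n), projection p ->
    (X A p -> feval (theta n) (cons_row p b) <= 0) /\
    (~ X A p -> g <= feval (theta n) (cons_row p b)).

Section GapFormula.
Variables (R : realType) (X : forall A : cstarAlgType R, A -> Prop).
Variables (theta : forall n, formula R (1 + n)) (g : R).
Hypothesis X_projection : forall (A : cstarAlgType R) (p : A),
  X p -> projection p.
Hypothesis g_gt0 : 0 < g.
Hypothesis theta_gap : gap_formula X theta g.

Definition head_var n : term R (1 + n) := TVar R (lshift n 0).

Lemma head_varE (A : cstarAlgType R) n (x : A) (b : 'rV[A]_n) :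
  teval (head_var n) (cons_row x b) = x.
Proof. by rewrite /= row_mxEl mxE. Qed.

Definition defect n : formula R (1 + n) :=
  fmax (fmax (FDist (TStar (head_var n)) (head_var n))
    (FDist (TMul (head_var n) (head_var n)) (head_var n))) (theta n).

Lemma defectE (A : cstarAlgType R) n (x : A) (b : 'rV[A]_n) :
  feval (defect n) (cons_row x b) =
  Num.max (Num.max (rnorm (x^*' - x)) (rnorm (x ** x - x)))
    (feval (theta n) (cons_row x b)).
Proof. by rewrite !fmaxE /= !row_mxEl !mxE. Qed.

Lemma defect_ge0 (A : cstarAlgType R) n (x : A) (b : 'rV[A]_n) :
  0 <= feval (defect n) (cons_row x b).
Proof. by rewrite defectE !le_max rnorm_ge0. Qed.

Lemma defect_eq0 (A : cstarAlgType R) n (p : A) (b : 'rV[A]_n) : X p ->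
  feval (defect n) (cons_row p b) = 0.
Proof.
move=> Xp; apply/le_anti; rewrite defect_ge0 andbT defectE.
have [ps pp] := X_projection Xp.
by rewrite ps pp !subrr rnorm0 !ge_max lexx (theta_gap b (conj ps pp)).1.
Qed.

Lemma defect_le0 (A : cstarAlgType R) n (x : A) (b : 'rV[A]_n) :
  feval (defect n) (cons_row x b) <= 0 -> X x.
Proof.
rewrite defectE !ge_max => /andP[/andP[h1 h2] h3].
have xP : projection x.
  by split; apply/eqP; rewrite -subr_eq0; apply/eqP/rnorm_le0.
apply: contrapT => /((theta_gap b xP).2) h.
by have := lt_le_trans g_gt0 (le_trans h h3); rewrite ltxx.
Qed.

Lemma cball1_projection (A : cstarAlgType R) (p : A) :
  projection p -> cball 1 p.
Proof. exact: rnorm_projection_le1. Qed.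

Lemma tuple_dist_le_head (A : cstarAlgType R) n (x y : A) (b : 'rV[A]_n) d :
  rnorm (x - y) <= d -> tuple_dist_le d (cons_row x b) (cons_row y b).
Proof.
move=> xy; apply: tuple_dist_le_cons => [i|]; first by rewrite !mxE.
by apply: tuple_dist_le_refl; apply: le_trans xy; exact: rnorm_ge0.
Qed.

(** The self-adjoint part [a] of [x] is almost idempotent, hence close to a projection [p]; the
    modulus of [theta] keeps its value at [p] below the gap, so [p] is in [X]. *)
Lemma defect_near n (N e : R) : 0 < e -> exists2 eta : R, 0 < eta &
  forall (A : cstarAlgType R) (x : A) (b : 'rV[A]_n),
    cball 1 x -> tuple_ball N b -> feval (defect n) (cons_row x b) < eta ->
    exists2 p, X p & rnorm (p - x) <= e.
Proof.
move=> e0; have g20 : 0 < g / 2 by rewrite divr_gt0.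
have [d [d0 hd]] := filter_ex (filterI (nbhs_right_gt 0)
  (feval_uniformly_continuous (theta n) (Num.max N 1%:R) g20)).
set e1 := Num.min e d.
have e10 : 0 < e1 by rewrite lt_min e0.
(* [g / 2] leaves room for a variation [g / 2] of [theta]; [1/24] gives [|a^2 - a| <= 1/8]; and
   [e1 / 31] absorbs the factor 10 of [projection_near] together with the distance from [x] to
   [a]. *)
exists (Num.min (g / 2) (Num.min 24^-1 (e1 / 31))).
  by rewrite !lt_min g20 invr_gt0 divr_gt0// ltr0n.
move=> A x b x1 bN; rewrite defectE !gt_max !lt_min.
move=> /andP[/andP[/and3P[_ s1 s2] /and3P[_ i1 i2]] /and3P[t1 _ _]].
move: s1 s2 i1 i2; set eta := rnorm (x^*' - x); set iota := rnorm (_ ** _ - x).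
move=> s1 s2 i1 i2.
pose a := (2^-1)%:C *: (x + x^*').
have as_ : a^*' = a by rewrite cstarZr cstarD cstarK addrC.
have ax : rnorm (a - x) = eta / 2.
  rewrite (_ : a - x = (2^-1)%:C *: (x^*' - x)).
    by rewrite rnormZr ger0_norm ?invr_ge0// mulrC.
  have xx : (2^-1)%:C *: x + (2^-1)%:C *: x = x.
    rewrite -scalerDl -rmorphD/= (_ : _ + _ = 1) ?scale1r//.
    by rewrite -[LHS]/(2^-1 + 2^-1 : R); lra.
  by rewrite /a scalerBr scalerDr -[X in _ - X = _]xx opprD addrACA subrr add0r.
have x1' : rnorm x <= 1 by [].
have a1 : rnorm a <= 1.
  rewrite rnormZr ger0_norm ?invr_ge0//.
  by have := ler_rnormD x x^*'; rewrite rnorm_star; lra.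
have aa : rnorm (a ** a - a) <= iota + 3 * (eta / 2).
  rewrite (_ : _ - a = (x ** x - x) + ((a - x) ** a + x ** (a - x) - (a - x))).
    apply: le_trans (ler_rnormD _ _) _; rewrite lerD2l.
    apply: le_trans (ler_rnormB _ _) _; rewrite ax.
    have := ler_rnormD ((a - x) ** a) (x ** (a - x)).
    have := rnormMl (lexx (rnorm (a - x))) a1.
    have := rnormMl x1' (lexx (rnorm (a - x))).
    by rewrite ax; lra.
  ncring.
have [|p pP pa] := projection_near as_; first by lra.
have px : rnorm (p - x) <= e1.
  by have := ler_rdistD a p x; rewrite ax; lra.
exists p; last by apply: le_trans px _; rewrite ge_min lexx.
apply: contrapT => /((theta_gap b pP).2) Xp.
have pd : tuple_dist_le d (cons_row p b) (cons_row x b).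
  by apply: tuple_dist_le_head; apply: le_trans px _; rewrite ge_min lexx orbT.
have := hd A _ _ (tuple_ball_cons (cball1_projection pP) bN)
  (tuple_ball_cons x1 bN) pd.
by rewrite ler_norml => /andP[_]; rewrite /cons_row in Xp t1 *; lra.
Qed.

Lemma sup_over_approx n (t : 'I_n -> nat) (psi : formula R (1 + n)) (c e : R) :
  0 < e -> exists phi : formula R n, forall (A : cstarAlgType R) (b : 'rV[A]_n),
    sorts_prod t b ->
    `|sup_over c (tuples1 (@X A)) psi b - feval phi b| <= e.
Proof.
move=> e0; set N : R := (\max_i t i)%:R.
have [M [M0 hM]] := filter_ex (filterI (nbhs_pinfty_gt (num_real 0))
  (feval_bounded psi (Num.max N 1%:R))).
have [d [d0 hd]] := filter_ex (filterI (nbhs_right_gt 0)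
  (feval_uniformly_continuous psi (Num.max N 1%:R) e0)).
have [eta eta0 heta] := defect_near n N d0.
(* Where the defect is at least [eta] the penalty is at least [2 M], so [chi <= - M], a lower bound
   of [psi] on the set. Where it is smaller, a member of the set is within [d], and [psi] changes by
   at most [e]. *)
pose chi := faffine 0 1 (- (2 * M / eta)) psi (defect n).
(* The infimum of the defect is 0 if the set is nonempty and at least [eta] if it is empty, so the
   switch selects the penalized supremum or [c]. *)
exists (finterpolate eta^-1 c (FInf 1 (defect n)) (FSup 1 chi)).
move=> A b /sorts_prod_tuple_ball bN; rewrite finterpolateE.
set E := feval (FInf _ _) b; set S := feval (FSup _ _) b.
have ballE x : cball 1 x -> `|feval psi (cons_row x b)| <= M.
  by move=> x1; apply: hM; exact: tuple_ball_cons.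
have chiE x : feval chi (cons_row x b) =
    feval psi (cons_row x b) - 2 * M / eta * feval (defect n) (cons_row x b).
  by rewrite faffineE add0r mul1r mulNr.
have K0 : 0 <= 2 * M / eta by rewrite divr_ge0 ?mulr_ge0// ltW.
have chi_le x : feval chi (cons_row x b) <= feval psi (cons_row x b).
  by rewrite chiE gerBl mulr_ge0// defect_ge0.
have rowE (a : 'rV[A]_1) : row_mx a b = cons_row (a 0 0) b.
  by congr row_mx; apply/rowP => i; rewrite ord1 mxE.
rewrite /sup_over; case: pselect => [[a0 Xa0]|Xn].
  have E0 : E = 0.
    apply/le_anti/andP; split.
      rewrite -(defect_eq0 b Xa0); apply: (inf_image_le (M := 0)).
        by move=> x _; exact: defect_ge0.
      exact/cball1_projection/X_projection.
    apply: le_inf_image; first exact: cball_neq0.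
    by move=> x _; exact: defect_ge0.
  rewrite /interpolate E0 mulr0 min_r// subr0 mul1r mul0r addr0.
  have psiM (a : 'rV[A]_1) : tuples1 (@X A) a -> feval psi (row_mx a b) <= M.
    move=> Xa; rewrite rowE; apply: le_trans (ler_norm _) _; apply: ballE.
    exact/cball1_projection/X_projection.
  have le_sup p : X p -> feval psi (cons_row p b) <=
      sup [set feval psi (row_mx a b) | a in tuples1 (@X A)].
    move=> Xp; apply: (le_sup_image psiM (x := const_mx p)).
    by rewrite /tuples1/= mxE.
  rewrite ler_distl; apply/andP; split.
    rewrite lerBlDr; apply: sup_image_le; first exact: cball_neq0.
    move=> x x1; have [De|De] := ltP (feval (defect n) (cons_row x b)) eta.
      have [p Xp px] := heta A x b x1 bN De.
      apply: le_trans (chi_le x) _.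
      have pd := tuple_dist_le_head b px.
      have pb := tuple_ball_cons (cball1_projection (X_projection Xp)) bN.
      have := hd A _ _ pb (tuple_ball_cons x1 bN) pd.
      rewrite ler_norml => /andP[h _]; have := le_sup _ Xp.
      by rewrite /cons_row; lra.
    apply: (@le_trans _ _ (- M)).
      have := ballE _ x1; rewrite ler_norml => /andP[_ h].
      have h2 : 2 * M <= 2 * M / eta * feval (defect n) (cons_row x b).
        by rewrite -mulrA ler_peMr ?mulr_ge0 ?(ltW M0)// ler_pdivlMl// mulr1.
      by rewrite -[leLHS]/(feval chi (cons_row x b)) chiE; lra.
    have := ballE _ (cball1_projection (X_projection Xa0)).
    rewrite ler_norml => /andP[h _]; have := le_sup _ Xa0; lra.
  rewrite -[leLHS]addr0 lerD ?(ltW e0)//.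
  apply: sup_image_le; first by exists a0.
  move=> a Xa; rewrite rowE.
  (* The penalty vanishes on the set, where [chi] and [psi] agree. *)
  rewrite -[leLHS]subr0 -(mulr0 (2 * M / eta)) -(defect_eq0 b Xa) -chiE.
  apply: (@le_sup_image _ _ _ (fun x => feval chi (cons_row x b)) M).
    move=> x x1; apply: le_trans (chi_le x) _.
    by apply: le_trans (ler_norm _) _; exact: ballE.
  exact/cball1_projection/X_projection.
have Ee : eta <= E.
  apply: le_inf_image; first exact: cball_neq0.
  move=> x x1; rewrite leNgt; apply/negP => De; have [p Xp _] := heta A x b x1 bN De.
  by apply: Xn; exists (const_mx p); rewrite /tuples1/= mxE.
rewrite /interpolate min_l; last by rewrite ler_pdivlMl// mulr1.
by rewrite subrr mul0r add0r mul1r subrr normr0 ltW.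
Qed.

(** The value [c] taken on the empty set changes sign as well. *)
Lemma inf_overE (A : cstarAlgType R) n (c : R) (Y : set 'rV[A]_1)
    (psi : formula R (1 + n)) (b : 'rV[A]_n) :
  inf_over c Y psi b = - sup_over (- c) Y (faffine 0 (-1) 0 psi psi) b.
Proof.
rewrite /inf_over /sup_over; case: pselect => [?|?]; last by rewrite opprK.
have -> : [set feval (faffine 0 (-1) 0 psi psi) (row_mx a b) | a in Y] =
    [set - feval psi (row_mx a b) | a in Y].
  by apply: eq_imagel => a _; rewrite faffineE mul0r addr0 add0r mulN1r.
by rewrite sup_imageN [RHS]opprK.
Qed.

Lemma gap_definable :
  definable_set (@all_cstar_algebras R) (fun=> 1%N) (fun A => tuples1 (@X A)).
Proof.
split; first split.
- move=> A _; split.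
    by move=> a Xa i; rewrite ord1; exact/cball1_projection/X_projection.
  (* Closedness: the defect is continuous and vanishes exactly on the set. *)
  move=> a cla; pose b : 'rV[A]_0 := const_mx 0.
  apply: (@defect_le0 _ 0 _ b); apply/ler_addgt0Pr => e e0; rewrite add0r.
  have [d [d0 hd]] := filter_ex (filterI (nbhs_right_gt 0)
    (feval_uniformly_continuous (defect 0) (Num.max 1 (rnorm (a 0 0))) e0)).
  have dC : 0 < d%:C by rewrite ltcR.
  have [a' [Xa' [_ aa']]] := cla _ (nbhsx_ballx a _ dC).
  have ad : rnorm (a 0 0 - a' 0 0) <= d.
    have := aa' 0 0; rewrite -ball_normE/= rnormE ltcR; exact: ltW.
  have tb x : rnorm x <= Num.max 1 (rnorm (a 0 0)) ->
      tuple_ball (Num.max 1 (rnorm (a 0 0))) (cons_row x b).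
    move=> xN i; case: (split_ordP i) => j ->; last by case: j.
    by rewrite row_mxEl mxE.
  have := hd A _ _ (tb (a 0 0) _) (tb (a' 0 0) _) (tuple_dist_le_head b ad).
  rewrite (defect_eq0 b Xa') subr0 => h; apply: le_trans (ler_norm _) _.
  apply: h; rewrite le_max ?lexx ?orbT//.
  by rewrite (cball1_projection (X_projection Xa')).
- move=> A B j _ _ hj; split.
    (* An elementary embedding preserves the value of the defect, hence membership. *)
    move=> a Xa; pose b : 'rV[A]_0 := const_mx 0.
    apply: (@defect_le0 _ 0 _ (map_mx j b)).
    have -> : cons_row (map_mx j a 0 0) (map_mx j b) =
        map_mx j (cons_row (a 0 0) b).
      by rewrite /cons_row map_row_mx map_const_mx mxE.
    by rewrite hj defect_eq0.
  move=> a a' _ _ i; rewrite ord1.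
  (* Isometry is preservation of the formula for the distance of two variables. *)
  have := hj 2 (FDist (TVar R 0) (TVar R 1))
    (\row_i if i == 0 then a 0 0 else a' 0 0).
  by rewrite /= !mxE.
- move=> n t psi c; split; apply: definable_predicateP => e e0.
    have [phi hphi] := sup_over_approx t psi c e0.
    by exists phi => A _ b; exact: hphi.
  have [phi hphi] := sup_over_approx t (faffine 0 (-1) 0 psi psi) (- c) e0.
  exists (faffine 0 (-1) 0 phi phi) => A _ b /hphi.
  rewrite inf_overE faffineE mul0r addr0 add0r mulN1r.
  by rewrite -opprD normrN.
Qed.

(** A single axiom suffices: the infimum of the defect over the unit ball is 0. Stability turns an
    almost zero of the defect into a member of [X]. *)
Lemma gap_elementary :
  elementary (fun A : cstarAlgType R => exists p : A, X p).
Proof.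
exists [set FInf 1 (defect 0)] => A.
pose b : 'rV[A]_0 := const_mx 0.
split=> [[p Xp] _ ->|/(_ _ erefl) E0].
  apply/le_anti/andP; split.
    rewrite -(defect_eq0 b Xp); apply: (inf_image_le (M := 0)).
      by move=> x _; exact: defect_ge0.
    exact/cball1_projection/X_projection.
  apply: le_inf_image; first exact: cball_neq0.
  by move=> x _; exact: defect_ge0.
(* Any tolerance would do, as only the existence of a nearby member matters. *)
have [eta eta0 heta] := @defect_near 0 0 1 ltr01.
apply: contrapT => Xn; have : eta <= 0; last by rewrite leNgt eta0.
rewrite -E0; apply: le_inf_image; first exact: cball_neq0.
move=> x x1; rewrite leNgt; apply/negP => h.
have [|p Xp _] := heta A x b x1 _ h; first by case.
by apply: Xn; exists p.
Qed.

(** For a projection, [1 - |p|] is 0 if [p] is nonzero and 1 otherwise, so zero is excluded with gap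
    1. *)
Definition nonzero_formula n : formula R (1 + n) :=
  fmax (theta n) (faffine 1 (-1) 0 (FDist (head_var n) (TZero R _))
    (FDist (head_var n) (TZero R _))).

Lemma nonzero_gap : g <= 1 ->
  gap_formula (fun A (p : A) => X p /\ p != 0) nonzero_formula g.
Proof.
move=> g1 A p n b pP; have [h1 h2] := theta_gap b pP.
rewrite fmaxE faffineE mul0r addr0 mulN1r.
have -> : feval (FDist (head_var n) (TZero R _)) (cons_row p b) = rnorm p.
  by rewrite -[LHS]/(rnorm (teval (head_var n) (cons_row p b) - 0)) subr0
    head_varE.
split=> [[Xp p0]|Xp].
  by rewrite rnorm_projection// subrr ge_max h1/=.
have [p0|p0] := eqVneq p 0.
  by rewrite p0 rnorm0 subr0 le_max g1 orbT.
by rewrite le_max h2// => Xp'; apply: Xp.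
Qed.

End GapFormula.

(** * The gap formulas for abelian, infinite and finite projections *)

Section Formulas.
Variable R : realType.

(** The corner is not a sort, but for a projection [p] its unit ball is the image of that of [A]
    under compression. *)
Definition compress_term n (p x : term R n) := TMul (TMul p x) p.

Definition commutator_formula n : formula R (1 + n) :=
  let y : term R (1 + (1 + (1 + n))) := TVar R (lshift _ 0) in
  let x : term R (1 + (1 + (1 + n))) := TVar R (rshift 1 (lshift _ 0)) in
  let p : term R (1 + (1 + (1 + n))) :=
    TVar R (rshift 1 (rshift 1 (lshift n 0))) in
  FSup 1 (FSup 1 (FDist
    (TMul (compress_term p x) (compress_term p y))
    (TMul (compress_term p y) (compress_term p x)))).

Lemma commutator_formulaE (A : cstarAlgType R) (p : A) n (b : 'rV[A]_n) :
  feval (commutator_formula n) (cons_row p b) =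
  sup [set sup [set rnorm (p ** x ** p ** (p ** y ** p) -
    p ** y ** p ** (p ** x ** p)) | y in cball 1] | x in cball 1].
Proof.
rewrite /=; congr (sup _); apply: eq_imagel => x _.
congr (sup _); apply: eq_imagel => y _.
by rewrite !(row_mxEl, row_mxEr, mxE).
Qed.

Lemma abelian_gap_formula :
  gap_formula (@abelian_projection R) commutator_formula 1.
Proof.
move=> A p n b pP; rewrite commutator_formulaE; split.
  move=> [_ ab]; apply: sup_image_le => [|x x1]; first exact: cball_neq0.
  apply: sup_image_le => [|y y1]; first exact: cball_neq0.
  by rewrite (ab _ _ (corner_compress p x) (corner_compress p y)) subrr rnorm0.
move=> nab; rewrite leNgt; apply/negP => lt1; apply: nab; split => //.
have bnd x y : cball 1 x -> cball 1 y -> rnorm (p ** x ** p ** (p ** y ** p) -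
    p ** y ** p ** (p ** x ** p)) <= 2.
  move=> x1 y1; apply: le_trans (ler_rnormB _ _) _.
  have cx := le_trans (rnorm_compress pP x) x1.
  have cy := le_trans (rnorm_compress pP y) y1.
  by have := rnormMl cx cy; have := rnormMl cy cx; lra.
(* The value of the formula, assumed to be less than 1, serves as [t]. *)
apply: (abelian_gap pP lt1) => x y xc yc x1 y1.
apply: (@le_trans _ _ (sup [set rnorm (p ** x ** p ** (p ** z ** p) -
    p ** z ** p ** (p ** x ** p)) | z in cball 1])).
  rewrite -{1 2}(compress_id pP xc) -{1 2}(compress_id pP yc).
  apply: (@le_sup_image _ _ _ (fun z => rnorm (p ** x ** p ** (p ** z ** p) -
    p ** z ** p ** (p ** x ** p))) 2) => // z z1.
  exact: bnd.
apply: (@le_sup_image _ _ _ (fun x => sup [set rnorm (p ** x ** p **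
  (p ** z ** p) - p ** z ** p ** (p ** x ** p)) | z in cball 1]) 2) => // z z1.
by apply: sup_image_le => [|u u1]; [exact: cball_neq0|exact: bnd].
Qed.

(** Small when the compression of [v] is almost an isometry of the corner whose range projection is
    at distance nearly 1 or more from [p]. *)
Definition isometry_condition n : formula R (1 + (1 + n)) :=
  let v : term R (1 + (1 + n)) := TVar R (lshift _ 0) in
  let p : term R (1 + (1 + n)) := TVar R (rshift 1 (lshift n 0)) in
  let w := compress_term p v in
  let range_defect := FDist (TMul w (TStar w)) p in
  fmax (FDist (TMul (TStar w) w) p)
    (faffine 1 (-1) 0 range_defect range_defect).

Lemma isometry_conditionE (A : cstarAlgType R) (p v : A) n (b : 'rV[A]_n) :
  feval (isometry_condition n) (cons_row v (cons_row p b)) =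
  let w := p ** v ** p in
  Num.max (rnorm (w^*' ** w - p)) (1 - rnorm (w ** w^*' - p)).
Proof.
rewrite fmaxE faffineE mul0r addr0 mulN1r /=.
by rewrite !(row_mxEl, row_mxEr, mxE).
Qed.

Definition isometry_formula n : formula R (1 + n) := FInf 1 (isometry_condition n).

Lemma isometry_formulaE (A : cstarAlgType R) (p : A) n (b : 'rV[A]_n) :
  feval (isometry_formula n) (cons_row p b) =
  inf [set (let w := p ** v ** p in Num.max (rnorm (w^*' ** w - p))
    (1 - rnorm (w ** w^*' - p))) | v in cball 1].
Proof. by congr (inf _); apply: eq_imagel => v _; exact: isometry_conditionE. Qed.

(** A nonunitary isometry attains the value 0. If [p] is finite, either [w^* w] is farther than 1/8
    from [p], or [finite_gap] makes the second entry of the maximum at least 1/2. *)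
Lemma infinite_gap_formula :
  gap_formula (@infinite_projection R) isometry_formula 8^-1.
Proof.
move=> A p n b pP; rewrite isometry_formulaE; split.
  move=> [_ /contrapT pinf]; have [w [wc w1 ww wwp]] := infinite_gap pP pinf.
  set f := fun v : A => _.
  have f0 : f w = 0.
    by rewrite /f (compress_id pP wc) ww wwp !subrr rnorm0 maxxx.
  rewrite -f0; apply: (inf_image_le (M := 0)) => // v _.
  by rewrite le_max rnorm_ge0.
move=> pfin; apply: le_inf_image => [|v v1]; first exact: cball_neq0.
have pf : finite_subalg (corner p).
  by move=> pinf; apply: pfin; split => // /(_ pinf).
have w1 := le_trans (rnorm_compress pP v) v1.
rewrite le_max; apply/orP.
have [h|h] := leP (rnorm ((p ** v ** p)^*' ** (p ** v ** p) - p)) 8^-1.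
  by right; have := finite_gap pP pf (corner_compress p v) w1 h; lra.
by left; exact: ltW.
Qed.

(** Finite projections are the other side of the gap for infinite ones, so reflecting the values
    exchanges the two sides. *)
Definition finiteness_formula n : formula R (1 + n) :=
  faffine 8^-1 (-1) 0 (isometry_formula n) (isometry_formula n).

Lemma finite_gap_formula :
  gap_formula (@finite_projection R) finiteness_formula 8^-1.
Proof.
move=> A p n b pP; have [h1 h2] := infinite_gap_formula b pP.
rewrite faffineE mul0r addr0 mulN1r; split.
  by move=> [_ pf]; rewrite subr_le0 h2// => -[].
move=> pf; rewrite lerDl oppr_ge0 h1//; split => // pf'.
by apply: pf.
Qed.

End Formulas.

Theorem proposition3p13p5 (R : realType) :
  let C := @all_cstar_algebras R in
  let s : 'I_1 -> nat := fun=> 1%N in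
  (* zero being allowed as an abelian or finite projection *)
  [/\ definable_set C s (fun A => tuples1 (@abelian_projection R A)),
      definable_set C s (fun A => tuples1 (@finite_projection R A)) &
      definable_set C s (fun A => tuples1 (@infinite_projection R A))] /\
  [/\ elementary (fun A : cstarAlgType R => exists p : A, abelian_projection p),
      elementary (fun A : cstarAlgType R => exists p : A, finite_projection p) &
      elementary
        (fun A : cstarAlgType R => exists p : A, infinite_projection p)] /\
  (* the same when projections are required to be nonzero *)
  [/\ definable_set C s
        (fun A => tuples1 (fun p : A => abelian_projection p /\ p != 0)),
      definable_set C s
        (fun A => tuples1 (fun p : A => finite_projection p /\ p != 0)),
      elementary (fun A : cstarAlgType R =>
        exists p : A, abelian_projection p /\ p != 0) &
      elementary (fun A : cstarAlgType R =>
        exists p : A, finite_projection p /\ p != 0)].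
Proof.
have g8 : 0 < 8^-1 :> R by rewrite invr_gt0.
have g81 : 8^-1 <= 1 :> R by rewrite invf_le1// ler1n.
have ab := @abelian_gap_formula R; have fi := @finite_gap_formula R.
have inf := @infinite_gap_formula R.
have abp (A : cstarAlgType R) (p : A) :
  abelian_projection p -> projection p by case.
have fip (A : cstarAlgType R) (p : A) :
  finite_projection p -> projection p by case.
have infp (A : cstarAlgType R) (p : A) :
  infinite_projection p -> projection p by case.
(* Zero is an abelian and finite projection but never an infinite one, so only these two cases have
   a nonzero variant. *)
have ab0 := nonzero_gap ab (lexx 1); have fi0 := nonzero_gap fi g81.
have ab0p (A : cstarAlgType R) (p : A) :
  abelian_projection p /\ p != 0 -> projection p by case=> /abp.
have fi0p (A : cstarAlgType R) (p : A) :
  finite_projection p /\ p != 0 -> projection p by case=> /fip.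
split; [split|split; split].
- exact: gap_definable abp ltr01 ab.
- exact: gap_definable fip g8 fi.
- exact: gap_definable infp g8 inf.
- exact: gap_elementary abp ltr01 ab.
- exact: gap_elementary fip g8 fi.
- exact: gap_elementary infp g8 inf.
- exact: gap_definable ab0p ltr01 ab0.
- exact: gap_definable fi0p g8 fi0.
- exact: gap_elementary ab0p ltr01 ab0.
- exact: gap_elementary fi0p g8 fi0.
Qed.
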